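(* Let $\phi\in\{\phi_{sq},\phi_{svm},\phi_{KL}\}$. For any sequence of instances and labels $(X_t,R_t)_{t\in[T]}$, applying the algorithm RTop-kF (contextual) described in the context, with top-1 feedback for $\phi_{sq}$ and $\phi_{KL}$ and top-2 feedback for $\phi_{svm}$ (and with $\eta=O(T^{-2/3})$, $\gamma=O(T^{-1/3})$), will produce the following bound: $$\mathbb{E}\Big[\sum_{t=1}^T\phi(\tilde s_t,R_t)\Big]-\min_{w:\|w\|_2\le U}\sum_{t=1}^T\phi(X_tw,R_t)\ \le\ C^\phi\,O(T^{2/3}),$$ where $C^\phi\in\{C^{sq},C^{svm},C^{KL}\}$ is a surrogate dependent function, namely a polynomial function of $R_D,m,U,R_{\max}$ whose degrees depend on the surrogate, with no degree ever greater than four, and for which $\mathbb{E}_t[\|\tilde z_t\|_2^2]\le C^\phi/\gamma$. The expectation in the regret is taken over the underlying randomness of the algorithm over the $T$ rounds.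
   Context: Instances are matrices $X_t\in\mathbb{R}^{m\times d}$ ($m$ documents) whose rows have $\ell_2$ norm at most $R_D$; labels are relevance vectors $R_t\in\{0,1,\dots,R_{\max}\}^m$. The sequence is generated by an oblivious adversary. For a score vector $s\in\mathbb{R}^m$, $\mathrm{argsort}(s)$ is the permutation (from ranks to documents) sorting $s$ in descending order. $U>0$ bounds the $\ell_2$ norm of ranking parameters $w\in\mathbb{R}^d$. $e_i$ are the standard basis vectors of $\mathbb{R}^m$. $\mathbb{E}_t$ is the expectation with respect to the randomization at round $t$, conditioned on $w_1,\dots,w_t$. Surrogates: $\phi_{sq}(s,R)=\|s-R\|_2^2$; $\phi_{svm}(s,R)=\sum_{i\ne j}\mathbb{1}(R(i)>R(j))\max(0,1+s(j)-s(i))$; $\phi_{KL}(s,R)=\sum_{i=1}^m e^{R(i)}\log(e^{R(i)})-\sum_{i=1}^m e^{R(i)}\log(e^{s(i)})-\sum_{i=1}^m e^{R(i)}+\sum_{i=1}^m e^{s(i)}$. Algorithm RTop-kF (contextual), with exploration parameter $\gamma\in(0,1/2)$ and learning parameter $\eta>0$; $w_1=\mathbf{0}\in\mathbb{R}^d$. For $t=1,\dots,T$: receive $X_t$; let $s=X_tw_t$ and $\sigma_t=\mathrm{argsort}(s)$. With probability $1-\gamma$ set $\tilde s_t=s$, and with probability $\gamma$ draw $\tilde s_t$ uniformly from $[0,1]^m$. Output $\tilde\sigma_t=\mathrm{argsort}(\tilde s_t)$ (so $\tilde\sigma_t$ has distribution $\mathbb{P}_t(\sigma)=(1-\gamma)\mathbb{1}(\sigma=\sigma_t)+\gamma/m!$).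 Observe $R_t(\tilde\sigma_t(1)),\dots,R_t(\tilde\sigma_t(k))$ (top-$k$ feedback); suffer $\phi(\tilde s_t,R_t)$ (neither the loss nor $R_t$ is revealed). Form $\tilde z_t$, an unbiased estimator of $\nabla_{w=w_t}\phi(X_tw,R_t)$, as below; set $w=w_t-\eta\tilde z_t$ and $w_{t+1}=\min\{1,U/\|w\|_2\}\,w$. Estimators, writing $\sigma=\tilde\sigma_t$, $R=R_t$, $X=X_t$, and $p(j_1,\dots,j_r)=\mathbb{P}_t(\pi(1)=j_1,\dots,\pi(r)=j_r)$: for $\phi_{sq}$, $\tilde z_t=X^\top\big(2\big(s-\frac{R(\sigma(1))e_{\sigma(1)}}{p(\sigma(1))}\big)\big)$; for $\phi_{KL}$, $\tilde z_t=X^\top\frac{(\exp(s(\sigma(1)))-\exp(R(\sigma(1))))e_{\sigma(1)}}{p(\sigma(1))}$; for $\phi_{svm}$, $\tilde z_t=X^\top\frac{h_{\sigma(1),\sigma(2)}+h_{\sigma(2),\sigma(1)}}{p(\sigma(1),\sigma(2))+p(\sigma(2),\sigma(1))}$ with $h_{i,j}=\mathbb{1}(R(i)>R(j))\mathbb{1}(1+s(j)>s(i))(e_j-e_i)$.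
   Formalization: For the KL surrogate, C^KL is a polynomial of degree at most four in each of R_D, m, U, R_max and also e^{R_D U} and e^{R_max}, since no polynomial in R_D, m, U, R_max alone bounds the second moment; eta and gamma are of exact order T^{-2/3} and T^{-1/3}. *)

(* Defs.v *)
From HB Require Import structures.
From mathcomp Require Import all_boot all_order all_algebra fingroup perm.
From mathcomp Require Import all_classical all_reals all_analysis.

Set Implicit Arguments.
Unset Strict Implicit.
Unset Printing Implicit Defensive.

Import Order.TTheory GRing.Theory Num.Theory.
Import numFieldNormedType.Exports.

Local Open Scope ring_scope.

Section ProductMeasure.
Context {R : realType} {d : measure_display} {T : measurableType d}.

Definition tuple_cons (n : nat) (x : T * n.-tuple T) : n.+1.-tuple T :=
  [the n.+1.-tuple T of x.1 :: x.2].

Lemma measurable_tuple_cons n : measurable_fun setT (@tuple_cons n).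
Proof. exact: measurable_cons. Qed.

HB.instance Definition _ n :=
  isMeasurableFun.Build _ _ _ _ (@tuple_cons n) (@measurable_tuple_cons n).

(** The law of [n] independent draws from [P]. *)
Fixpoint iid (P : probability T R) (n : nat) : probability (n.-tuple T) R :=
  if n is n'.+1 then distribution (P \x iid P n')%E (@tuple_cons n')
  else \d_[tuple].

End ProductMeasure.

Inductive surrogate := Sq | Svm | KL.

(** The [k] of the top-[k] feedback. *)
Definition topk (phi : surrogate) : nat := if phi is Svm then 2 else 1.

Section Learner.
Variable R : realType.

(** The norm [`|_|] on matrices is the sup norm, whence this definition. *)
Definition l2norm (n : nat) (v : 'cV[R]_n) : R :=
  Num.sqrt (\sum_i v i 0 ^+ 2).

Section Ranking.
Variable m : nat.
Implicit Types (s : 'cV[R]_m) (lab : 'I_m -> nat).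

Definition phi_sq s lab : R := l2norm (s - \col_i (lab i)%:R) ^+ 2.

Definition phi_svm s lab : R :=
  \sum_i \sum_(j | i != j) (lab j < lab i)%N%:R * Num.max 0 (1 + s j 0 - s i 0).

Definition phi_KL s lab : R :=
  \sum_i expR (lab i)%:R * ln (expR (lab i)%:R)
  - \sum_i expR (lab i)%:R * ln (expR (s i 0))
  - \sum_i expR (lab i)%:R + \sum_i expR (s i 0).

Definition surrogate_loss (phi : surrogate) s lab : R :=
  match phi with
  | Sq => phi_sq s lab
  | Svm => phi_svm s lab
  | KL => phi_KL s lab
  end.

(** A permutation maps ranks (from 0) to documents. The sort is stable, so tied
    documents are ranked by increasing index. *)
Definition argsort_fun s : 'I_m -> 'I_m :=
  tnth (sort_tuple (fun i j => s j 0 <= s i 0) (ord_tuple m)).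

Lemma argsort_fun_inj s : injective (argsort_fun s).
Proof.
apply/tuple_uniqP => /=; rewrite sort_uniq; exact: enum_uniq.
Qed.

Definition argsort s : {perm 'I_m} := perm (@argsort_fun_inj s).

Definition top (k : nat) (sigma : {perm 'I_m}) : seq 'I_m :=
  take k [seq sigma i | i <- enum 'I_m].

Definition feedback (k : nat) (sigma : {perm 'I_m}) lab : seq ('I_m * nat) :=
  [seq (j, lab j) | j <- top k sigma].

Definition rank_prob (gamma : R) s (sigma : {perm 'I_m}) : R :=
  (1 - gamma) * (sigma == argsort s)%:R + gamma / (m`!)%:R.

(** Probability under [rank_prob] that the first ranks are occupied by the
    documents [js], in this order. *)
Definition top_prob (gamma : R) s (js : seq 'I_m) : R :=
  \sum_(sigma : {perm 'I_m} | top (size js) sigma == js) rank_prob gamma s sigma.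

Definition basis (i : 'I_m) : 'cV[R]_m := delta_mx i 0.

Definition svm_dir s (i j : 'I_m) (ri rj : nat) : 'cV[R]_m :=
  ((rj < ri)%N%:R * (s i 0 < 1 + s j 0)%R%:R) *: (basis j - basis i).

(** The estimator sees the labels only through the feedback [obs]. The default
    value [0] is reached only when there are fewer than [topk phi] documents. *)
Definition score_estimator (phi : surrogate) (gamma : R) s
    (obs : seq ('I_m * nat)) : 'cV[R]_m :=
  match phi, obs with
  | Sq, (j, r) :: _ =>
      2%:R *: (s - (r%:R / top_prob gamma s [:: j]) *: basis j)
  | KL, (j, r) :: _ =>
      ((expR (s j 0) - expR r%:R) / top_prob gamma s [:: j]) *: basis j
  | Svm, (i, ri) :: (j, rj) :: _ =>
      (top_prob gamma s [:: i; j] + top_prob gamma s [:: j; i])^-1 *: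
        (svm_dir s i j ri rj + svm_dir s j i rj ri)
  | _, _ => 0
  end.

(** The randomness of one round: whether to explore, and the uniform score
    vector played in that case. *)
Definition round_sample : measurableType _ :=
  (bool * m.-tuple (measurableTypeR R))%type.

Definition round_law (gamma : R) : probability round_sample R :=
  (bernoulli_prob gamma \x iid (uniform_prob (@ltr01 R)) m)%E.

Definition played_score s (rho : round_sample) : 'cV[R]_m :=
  if rho.1 then \col_i tnth rho.2 i else s.

End Ranking.

Section Trajectory.
Variables (m d : nat) (phi : surrogate) (U eta gamma : R).
Implicit Types (X : 'M[R]_(m, d)) (lab : 'I_m -> nat) (w : 'cV[R]_d).
Implicit Types rho : round_sample m.

Definition loss_at X lab rho w : R :=
  surrogate_loss phi (played_score (X *m w) rho) lab.

Definition grad_estimator X lab rho w : 'cV[R]_d :=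
  let s := X *m w in
  X^T *m score_estimator phi gamma s
           (feedback (topk phi) (argsort (played_score s rho)) lab).

(** For [w = 0], [U / 0 = 0] and the result is [0], as it should be. *)
Definition project w : 'cV[R]_d := Num.min 1 (U / l2norm w) *: w.

Definition update X lab rho w : 'cV[R]_d :=
  project (w - eta *: grad_estimator X lab rho w).

Section Run.
Variables (X : nat -> 'M[R]_(m, d)) (lab : nat -> 'I_m -> nat).

(** Rounds are numbered from 0; [param omega t] depends on [omega] only through
    the rounds before [t]. *)
Fixpoint param (omega : nat -> round_sample m) (t : nat) : 'cV[R]_d :=
  if t is t'.+1 then update (X t') (lab t') (omega t') (param omega t') else 0.

Definition sample_seq T (omega : T.-tuple (round_sample m)) (t : nat) :
    round_sample m :=
  nth (false, [tuple of nseq m 0]) omega t.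

Definition bounded_sequence (T : nat) (RD : R) (Rmax : nat) : Prop :=
  forall t, (t < T)%N ->
    (forall i, l2norm (row i (X t))^T <= RD) /\
    (forall i, (lab t i <= Rmax)%N).

Definition learner_loss T (omega : T.-tuple (round_sample m)) : R :=
  \sum_(t < T) loss_at (X t) (lab t) (sample_seq omega t)
                 (param (sample_seq omega) t).

Definition comparator_loss (T : nat) w : R :=
  \sum_(t < T) surrogate_loss phi (X t *m w) (lab t).

Definition expected_loss (T : nat) : \bar R :=
  ('E_(iid (round_law m gamma) T) [@learner_loss T])%E.

(** Integrating over the fresh randomness of round [t] alone, with the history
    [omega] fixed, is conditioning on the parameters up to round [t]. *)
Definition cond_second_moment (omega : nat -> round_sample m) (t : nat) :
    \bar R :=
  ('E_(round_law m gamma)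
     [fun rho =>
        (l2norm (grad_estimator (X t) (lab t) rho (param omega t)) ^+ 2)%R])%E.

End Run.
End Trajectory.

(** Polynomial in [k] variables, of degree at most 4 in each of them. *)
Definition poly4 (k : nat) (c : {ffun 'I_k -> 'I_5} -> R) (v : k.-tuple R) : R :=
  \sum_(a : {ffun 'I_k -> 'I_5}) c a * \prod_i tnth v i ^+ a i.

(** The gradient of [phi_KL] is exponential in scores and labels, so no
    polynomial in [RD, m, U, Rmax] alone bounds the second moment for [KL]: the
    largest values of [exp] on scores and labels are two further variables. *)
Definition admissible_constant (phi : surrogate)
    (C : R -> nat -> R -> nat -> R) : Prop :=
  match phi with
  | Sq | Svm =>
      exists c, forall RD m U Rmax,
        C RD m U Rmax = poly4 c [tuple RD; m%:R; U; Rmax%:R]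
  | KL =>
      exists c, forall RD m U Rmax,
        C RD m U Rmax =
        poly4 c [tuple RD; m%:R; U; Rmax%:R; expR (RD * U); expR Rmax%:R]
  end.

End Learner.

(* Main.v *)
Require Import Defs.
From HB Require Import structures.
From mathcomp Require Import all_boot all_order all_algebra fingroup perm.
From mathcomp Require Import action primitive_action alt.
From mathcomp Require Import all_classical all_reals all_analysis.
From mathcomp Require Import measurable_realfun ring lra.
Import Order.TTheory GRing.Theory Num.Theory.
Import numFieldNormedType.Exports.
Local Open Scope ring_scope.

(** Conditionally on the past, [argsort] of the played scores has law
    [rank_prob]: by exchangeability and the absence of ties, [argsort] of [m]
    independent uniform scores is a uniform permutation. Hence expectations over
    one round are finite sums over permutations, the estimator averages to a
    (sub)gradient of the surrogate, and since every top-[k] prefix has probability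
    at least [gamma / m ^ k] its second moment is at most [G / gamma].

    Projected online gradient descent against [u] in the ball of radius [U] then
    loses at most [U ^ 2 / (2 eta) + T eta G / (2 gamma)]. Playing uniform scores
    with probability [gamma] adds at most [T gamma B], where [B] bounds the
    surrogates on scores in [[0, 1]]. With the prescribed [eta] and [gamma] each
    of the three terms is of order [T ^ (2/3)]. The expected loss is bounded by
    induction on [T], integrating out the first round. *)

Set Implicit Arguments.
Unset Strict Implicit.
Unset Printing Implicit Defensive.

(** * Independent draws *)

(** The obstacle is that each parameter depends on all earlier draws. It does so only through the
    rankings played: once the starting point of a round is fixed, the updated parameter takes at
    most [m!] values. Conditional expectations can therefore be replaced by an induction whose
    hypothesis holds for every starting point [w] and every sequence of instances and labels, with
    [l2norm (w - u) ^+ 2 / (2 * eta)] as potential; measurability of the remaining loss is then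
    needed only at fixed [w]. Estimators are measured in the [l1] norm before being pulled back by
    [X^T]: rows of norm at most [RD] give [l2norm (X^T *m v) <= RD * l1norm v], and the [l1] norm of
    a basis vector is [1]. Inverse-probability weights enter the second moment squared, and
    averaging over the ranking cancels one power; this is why only a single [gamma] remains in the
    denominator. *)

Section IID.
Local Open Scope classical_set_scope.
Context {R : realType} {d : measure_display} {T : measurableType d}.
Implicit Types P : probability T R.

Definition box n (A : 'I_n -> set T) : set (n.-tuple T) :=
  [set v | forall i, A i (tnth v i)].

Lemma measurable_box n (A : 'I_n -> set T) :
  (forall i, measurable (A i)) -> measurable (box A).
Proof.
move=> mA.
have -> : box A = \bigcap_(i in [set: 'I_n]) ((@tnth n T)^~ i @^-1` A i).
  by apply/seteqP; split=> v /= Av i => [_|]; [exact: Av|exact: (Av i I)].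
apply: fin_bigcap_measurable => // i _; rewrite -[X in measurable X]setTI.
exact: measurable_tnth.
Qed.

Lemma iid_box P n (A : 'I_n -> set T) : (forall i, measurable (A i)) ->
  iid P n (box A) = (\prod_(i < n) P (A i))%E.
Proof.
elim: n A => [|n IH] A mA.
  by rewrite big_ord0 /= diracE mem_set// => -[].
rewrite big_ord_recl -IH => [|i]; last exact: mA.
transitivity ((P \x iid P n)%E (A ord0 `*` box (A \o lift ord0))).
  rewrite /= /pushforward; congr (product_measure1 _ _ _).
  apply/seteqP; split=> [[x v]/= Axv|[x v]/= [Ax Av] i].
    split=> [|i]; first exact: (Axv ord0).
    by have := Axv (lift ord0 i); rewrite tnthS.
  by case: (unliftP ord0 i) => [j ->|->]//; rewrite tnthS; exact: Av.
rewrite product_measure1E//.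
by apply: measurable_box => i; exact: mA.
Qed.

Definition permute_tuple n (tau : {perm 'I_n}) (v : n.-tuple T) : n.-tuple T :=
  [tuple tnth v (tau i) | i < n].

Lemma measurable_permute_tuple n (tau : {perm 'I_n}) :
  measurable_fun setT (permute_tuple tau).
Proof.
apply/measurable_fun_tnthP => i.
rewrite (_ : _ \o _ = (@tnth n T)^~ (tau i)); first exact: measurable_tnth.
by apply/funext => v /=; rewrite tnth_mktuple.
Qed.

(** Boxes form a pi-system generating the sigma-algebra of tuples. On a box the claim is
    commutativity of the product in [iid_box], and agreement on boxes extends to all measurable
    sets. *)
Lemma iid_permute P n (tau : {perm 'I_n}) (E : set (n.-tuple T)) :
  measurable E -> iid P n (permute_tuple tau @^-1` E) = iid P n E.
Proof.
move=> mE.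
pose G := [set B | exists2 A : 'I_n -> set T, forall i, measurable (A i) & B = box A].
have GI : setI_closed G.
  move=> _ _ [A mA ->] [B mB ->]; exists (fun i => A i `&` B i).
    by move=> i; exact: measurableI.
  by apply/seteqP; split=> [v [Av Bv] i|v ABv]; [split|split=> i; have [] := ABv i].
have GE : measurable = <<s G >>.
  apply/seteqP; split.
    apply: smallest_sub; first exact: smallest_sigma_algebra.
    rewrite -bigcup_seq => B [i _ [Y mY <-]].
    apply: sub_sigma_algebra.
    (* A generator constrains one coordinate, so it is a box with all other sides full. *)
    exists (fun j => if j == i then Y else setT).
      by move=> j; case: ifP.
    apply/seteqP; split=> v /=.
      by move=> [_ Yv] j; case: eqP => // ->.
    by move=> /(_ i); rewrite eqxx.
  apply: smallest_sub; first exact: sigma_algebra_measurable.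
  by move=> _ [A mA ->]; exact: measurable_box.
pose mt := isMeasurableFun.Build _ _ _ _ _ (measurable_permute_tuple tau).
pose f : {mfun n.-tuple T >-> n.-tuple T} := HB.pack (permute_tuple tau) mt.
suff : distribution (iid P n) f E = iid P n E by [].
apply: (@measure_unique _ R (n.-tuple T) G (fun=> setT) GE GI _ _
  (distribution (iid P n) f) (iid P n)) => //.
- by move=> _; exists (fun=> setT) => //; apply/seteqP; split.
- by rewrite bigcup_const//; exists 0%N.
- move=> _ [A mA ->].
  (* The preimage of the box with sides [A i] is the box with sides [A (tau^-1 i)]. *)
  have mA' i : measurable ((A \o tau^-1%g) i) by exact: mA.
  apply: etrans (esym (iid_box P mA)).
  rewrite (reindex_inj (@perm_inj _ tau^-1%g))/= -[RHS](iid_box P mA').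
  rewrite /distribution/pushforward; congr (iid P n _).
  apply/seteqP; split=> v Av i /=.
    by have := Av (tau^-1 i)%g; rewrite /= tnth_mktuple permKV.
  by have := Av (tau i); rewrite /= permK tnth_mktuple.
- move=> _; rewrite [ltLHS](_ : _ = 1%E) ?ltry//.
  exact: (probability_setT (distribution (iid P n) f)).
Qed.

Lemma iid_tnth P n i (A : set T) : measurable A ->
  iid P n [set v | A (tnth v i)] = P A.
Proof.
move=> mA; pose B (j : 'I_n) := if j == i then A else setT.
have mB j : measurable (B j) by rewrite /B; case: ifP.
have -> : [set v : n.-tuple T | A (tnth v i)] = box B.
  apply/seteqP; split=> v /=; first by move=> Av j; rewrite /B; case: eqP => // ->.
  by move=> /(_ i); rewrite /B eqxx.
rewrite iid_box// (bigD1 i)//= {1}/B eqxx big1 ?mule1// => j /negbTE ji.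
by rewrite /B ji probability_setT.
Qed.

End IID.

(** * Maps and integrals that factor through a finite type *)

Section FiniteFactor.
Local Open Scope classical_set_scope.

Lemma measurable_finite_factor d (T : measurableType d) (K : finType) (Z : Type)
    (h : T -> K) (g : T -> Z) (z : Z) :
  (forall k, measurable [set x | h x = k]) ->
  (forall x y, h x = h y -> g x = g y) -> measurable [set x | g x = z].
Proof.
move=> mh hg.
have -> : [set x | g x = z] =
    \bigcup_(k in [set k | exists2 y, h y = k & g y = z]) [set x | h x = k].
  apply/seteqP; split=> [x gx|x [k [y hy gy] hx]]; first by exists (h x) => //; exists x.
  by rewrite /= -gy; apply: hg; rewrite hx.
exact: fin_bigcup_measurable.
Qed.

Lemma integral_finite_factor (R : realType) d (T : measurableType d)
    (P : {measure set T -> \bar R}) (K : finType) (h : T -> K) (g : K -> R) :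
  (forall k, measurable [set x | h x = k]) -> (forall k, 0 <= g k) ->
  (\int[P]_x (g (h x))%:E = \sum_k (g k)%:E * P [set x | h x = k])%E.
Proof.
move=> mh g0.
under eq_integral => x _.
  rewrite (_ : (g (h x))%:E = \sum_k (g k)%:E * (\1_[set x | h x = k] x)%:E)%E.
    over.
  rewrite (bigD1 (h x))//= big1 ?adde0 => [|k /eqP kh].
    by rewrite indicE mem_set ?mule1.
  by rewrite indicE memNset ?mule0// => /= hk; apply: kh.
have mi k : measurable_fun setT (fun x => (\1_[set x | h x = k] x)%:E : \bar R).
  by apply/measurable_EFinP; exact: measurable_indic.
rewrite ge0_integral_sum//=.
- apply: eq_bigr => k _; rewrite ge0_integralZl//=.
    by rewrite integral_indic// setIT.
  by rewrite lee_fin.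
- by move=> k; apply: measurable_funeM; exact: mi.
- by move=> k x _; rewrite -EFinM lee_fin mulr_ge0.
Qed.

Lemma measurable_fun_finite_factor d d' (T : measurableType d) (K : finType)
    (T' : measurableType d') (h : T -> K) (g : K -> T') :
  (forall k, measurable [set x | h x = k]) -> measurable_fun setT (g \o h).
Proof.
move=> mh _ Y _; rewrite setTI.
have -> : (g \o h) @^-1` Y = \bigcup_(k in [set k | Y (g k)]) [set x | h x = k].
  by apply/seteqP; split=> [x Yx|x [k Yk /= hx]]; [exists (h x)|rewrite /= hx].
exact: fin_bigcup_measurable.
Qed.

End FiniteFactor.

(** * Sorting random scores *)

Section Argsort.
Variables (R : realType) (m : nat).
Implicit Types (s : 'cV[R]_m) (sigma : {perm 'I_m}).

Lemma eq_argsort s s' :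
  (forall i j, (s j 0 <= s i 0) = (s' j 0 <= s' i 0)) -> argsort s = argsort s'.
Proof.
move=> ss'; apply/permP => k; rewrite !permE /argsort_fun.
suff -> : (fun i j => s j 0 <= s i 0) = (fun i j => s' j 0 <= s' i 0) by [].
by apply/funext => i; apply/funext => j; exact: ss'.
Qed.

Lemma argsort_sorted s : sorted (fun i j => s j 0 <= s i 0) (codom (argsort s)).
Proof.
have -> : codom (argsort s) =
    sort_tuple (fun i j => s j 0 <= s i 0) (ord_tuple m) :> seq _.
  rewrite -[RHS]map_tnth_enum; apply: eq_codom => i; exact: permE.
by apply: sort_sorted => i j; exact: le_total.
Qed.

(** Comparing documents by score is antisymmetric only in the absence of ties; injectivity supplies
    this, and then a descending list with given elements is unique. *)
Lemma argsort_unique s sigma : injective (fun i => s i 0) ->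
  sorted (fun i j => s j 0 <= s i 0) (codom sigma) -> argsort s = sigma.
Proof.
move=> s_inj sig_sorted.
suff /eq_in_map e : codom (argsort s) = codom sigma.
  by apply/permP => i; apply: e; exact: mem_enum.
apply: (sorted_eq _ _ (argsort_sorted s) sig_sorted).
- by move=> j i k ji kj; exact: le_trans kj ji.
- by move=> i j /andP[ij ji]; apply: s_inj; apply/le_anti; rewrite ij ji.
- apply: uniq_perm; [exact/injectiveP/perm_inj|exact/injectiveP/perm_inj|].
  by move=> i; rewrite -[i in LHS](permKV (argsort s)) -[i in RHS](permKV sigma) !codom_f.
Qed.

End Argsort.

Section Uniform.
Local Open Scope classical_set_scope.
Variable R : realType.
Local Notation T := (measurableTypeR R).
Local Notation col v := (\col_i tnth v i).

(** [argsort] factors through the finite pattern of pairwise comparisons. *)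
Lemma measurable_argsort m (sigma : {perm 'I_m}) :
  measurable [set v : m.-tuple T | argsort (col v : 'cV[R]_m) = sigma].
Proof.
apply: (@measurable_finite_factor _ _ {ffun 'I_m * 'I_m -> bool} _
  (fun v : m.-tuple T => [ffun p => tnth v p.2 <= tnth v p.1 :> R])).
  move=> k.
  have -> : [set v : m.-tuple T | [ffun p => tnth v p.2 <= tnth v p.1 :> R] = k] =
     \bigcap_(p in [set: 'I_m * 'I_m])
       [set v : m.-tuple T | (tnth v p.2 <= tnth v p.1 :> R) = k p].
    apply/seteqP; split=> [v /= <- p _|v /= vk]; first by rewrite /= ffunE.
    by apply/ffunP => p; rewrite ffunE; exact: (vk p).
  apply: fin_bigcap_measurable => //.
  move=> p _; rewrite -[X in measurable X]setTI.
  have -> : [set v : m.-tuple T | (tnth v p.2 <= tnth v p.1 :> R) = k p] =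
   (fun v : m.-tuple T => (tnth v p.2 <= tnth v p.1 :> R)) @^-1` [set k p] by [].
  by apply: measurable_fun_ler => //; exact: measurable_tnth.
move=> v w vw; apply: eq_argsort => i j; rewrite !mxE.
by have /ffunP/(_ (i, j)) := vw; rewrite !ffunE.
Qed.

Lemma measurable_ties n : measurable [set v : n.-tuple T | ~~ uniq v].
Proof.
have -> : [set v : n.-tuple T | ~~ uniq v] =
    \bigcup_(p in [set p : 'I_n * 'I_n | p.1 != p.2])
      [set v : n.-tuple T | tnth v p.1 = tnth v p.2].
  apply/seteqP; split=> v /=.
    move/tuple_uniqP => v_inj; apply: contrapT => H; apply: v_inj => i j vij.
    by apply/eqP; apply: contrapT => /negP ij; apply: H; exists (i, j).
  by move=> [[i j] /= /eqP ij vij]; apply/tuple_uniqP => /(_ _ _ vij).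
apply: fin_bigcup_measurable => //.
move=> p _; rewrite -[X in measurable X]setTI.
have -> : [set v : n.-tuple T | tnth v p.1 = tnth v p.2] =
  (fun v : n.-tuple T => (tnth v p.1 == tnth v p.2 :> R)) @^-1` [set true].
  by apply/seteqP; split=> v /= /eqP.
by apply: measurable_fun_eqr => //; exact: measurable_tnth.
Qed.

(** A tie in [x :: v] is a tie in [v], null by induction, or an equality between [x] and some
    coordinate of [v], null by Tonelli because [Q] has no atoms. *)
Lemma iid_ties (Q : probability T R) n : (forall x, Q [set x] = 0%E) ->
  iid Q n [set v | ~~ uniq v] = 0%E.
Proof.
move=> Q0; elim: n => [|n IH].
  rewrite [X in iid _ _ X](_ : _ = set0) ?measure0//.
  by apply/seteqP; split=> // v; rewrite tuple0.
pose S i := [set z : T * n.-tuple T | z.1 = tnth z.2 i].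
have mS i : measurable (S i).
  rewrite -[X in measurable X]setTI.
  have -> : S i = (fun z : T * n.-tuple T => (z.1 == tnth z.2 i :> R)) @^-1` [set true].
    by apply/seteqP; split=> v /= /eqP.
  apply: measurable_fun_eqr => //.
  by apply: (measurableT_comp (measurable_tnth i)).
have S0 i : (Q \x iid Q n)%E (S i) = 0%E.
  rewrite /= /product_measure1 (eq_integral (cst 0%E)) ?integral0// => x _ /=.
  (* For fixed [x] the section of [S i] is the event that coordinate [i] equals [x]. *)
  rewrite -(Q0 x) -(iid_tnth Q i)//; congr (iid Q n _).
  by apply/seteqP; split=> v; rewrite /xsection /= inE /S /=.
have N0 : (Q \x iid Q n)%E (setT `*` [set v : n.-tuple T | ~~ uniq v]) = 0%E.
  rewrite product_measure1E//; last exact: measurable_ties.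
  by rewrite [X in (_ * X)%E]IH mule0.
have : (Q \x iid Q n)%E.-negligible
    (@tuple_cons _ _ n @^-1` [set v : n.+1.-tuple T | ~~ uniq v]).
  apply: (@negligibleS _ _ _ _
    ((setT `*` [set v : n.-tuple T | ~~ uniq v]) `|` \big[setU/set0]_i S i)).
    move=> [x v] /=; rewrite negb_and negbK => /orP[/tnthP[i xi]|vu]; last by left.
    by right; rewrite -bigcup_seq; exists i => //=; rewrite mem_index_enum.
  apply: negligibleU.
    by apply/negligibleP => //; apply: measurableX => //; exact: measurable_ties.
  apply: (@big_ind _ (fun A => (Q \x iid Q n)%E.-negligible A)) => [||i _].
  - exact: negligible_set0.
  - exact: negligibleU.
  - by apply/negligibleP => //; exact: S0.
move/negligibleP; apply; rewrite -[X in measurable X]setTI.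
by apply: measurable_tuple_cons => //; exact: measurable_ties.
Qed.

(** Permuting coordinates preserves [iid Q m] and carries one ranking to any other, up to ties. The
    [m!] events thus have equal mass, and their masses sum to one. *)
Lemma iid_argsort (Q : probability T R) m (sigma : {perm 'I_m}) :
  (forall x, Q [set x] = 0%E) ->
  iid Q m [set v | argsort (col v : 'cV[R]_m) = sigma] = (m`!%:R^-1)%:E.
Proof.
move=> Q0; pose A sigma := [set v : m.-tuple T | argsort (col v : 'cV[R]_m) = sigma].
have mA s : measurable (A s) by exact: measurable_argsort.
pose N := [set v : m.-tuple T | ~~ uniq v].
have N0 : iid Q m N = 0%E by exact: iid_ties.
have mN : measurable N by exact: measurable_ties.
have permA tau : iid Q m (A tau) = iid Q m (A 1%g).
  rewrite -(iid_permute Q tau^-1)//.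
  (* Adjoining the null set [N] to both events turns an equality up to ties into an equality of
     sets. *)
  rewrite -(measureU0 (mu := iid Q m) _ mN N0)//; last first.
    rewrite -[X in measurable X]setTI.
    by apply: measurable_permute_tuple.
  rewrite -[RHS](measureU0 (mu := iid Q m) _ mN N0)//.
  congr (iid Q m _).
  (* Coordinate [i] of the permuted tuple is coordinate [tau^-1 i] of [v]; ranking it and then
     applying [tau^-1] therefore lists the documents of [v] in descending order. *)
  have key (v : m.-tuple T) : uniq v ->
      (argsort (col (permute_tuple tau^-1 v) : 'cV[R]_m) * tau^-1)%g = argsort (col v).
    move=> v_uniq; apply/esym/argsort_unique.
      by move=> i j; rewrite !mxE; exact/tuple_uniqP.
    have := argsort_sorted (col (permute_tuple tau^-1 v) : 'cV[R]_m).
    rewrite !sorted_map; apply: sub_sorted => i j /=.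
    by rewrite !mxE !tnth_mktuple !permM.
  apply/seteqP; split=> v /= Av; have [vu|vu] := boolP (uniq v); try by right.
    by case: Av => [Av|]; [left; rewrite /A/= -key// Av mulgV|rewrite /N/= vu].
  case: Av => [Av|]; last by rewrite /N/= vu.
  by left; apply: (mulIg tau^-1%g); rewrite mulgV key.
(* The total mass is the integral of the constant [1], computed as a finite sum over rankings. *)
have : (\sum_(tau : {perm 'I_m}) iid Q m (A tau) = 1)%E.
  transitivity (\int[iid Q m]_v (cst 1%R (argsort (col v : 'cV[R]_m)))%:E)%E.
    rewrite integral_finite_factor//.
    by apply: eq_bigr => tau _; rewrite mul1e.
  by rewrite /= integral_cst// mul1e; exact: (probability_setT (iid Q m)).
rewrite (eq_bigr (fun=> iid Q m (A 1%g))) => [|tau _]; last exact: permA.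
rewrite -/(A sigma) (permA sigma).
have /fineK <- := fin_num_measure (iid Q m) _ (mA 1%g).
move: (fine _) => r; rewrite sumEFin => -[].
rewrite sumr_const card_Sn => mr.
congr EFin; rewrite -[RHS]mul1r -[X in _ = X * _]mr -[r *+ _]mulr_natr mulfK//.
Qed.

End Uniform.

(** * The law of one round *)

Section RoundLaw.
Local Open Scope classical_set_scope.
Variable R : realType.
Local Notation T := (measurableTypeR R).
Local Notation col v := (\col_i tnth v i).
Local Notation Q := (uniform_prob (@ltr01 R)).

Lemma uniform_prob_set1 (x : T) : Q [set x] = 0%E.
Proof.
have /null_content_dominatesP := dominates_uniform_prob (@ltr01 R).
by apply => //; exact: lebesgue_measure_set1.
Qed.

Lemma uniform_prob_itv01 : Q `[0, 1] = 1%E.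
Proof. by rewrite /uniform_prob integral_uniform_pdf1. Qed.

(** The bound on [f] holds only on the unit cube, but the cube has full mass, so it holds almost
    everywhere. *)
Lemma integral_iid_uniform_le m (f : m.-tuple T -> R) (B : R) :
  measurable_fun setT f -> (forall v, 0 <= f v) ->
  (forall v : m.-tuple T, (forall i, 0 <= tnth v i <= 1) -> f v <= B) ->
  (\int[iid Q m]_v (f v)%:E <= B%:E)%E.
Proof.
move=> mf f0 fB.
have B0 : 0 <= B.
  apply: le_trans (fB [tuple 0 | i < m] _) => // i.
  by rewrite tnth_mktuple lexx ler01.
have <- : (\int[iid Q m]_v (cst B%:E v) = B%:E)%E.
  by rewrite integral_cst// [X in (_ * X)%E](probability_setT (iid Q m)) mule1.
apply: ae_ge0_le_integral => //.
- by move=> v _; rewrite lee_fin.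
- exact/measurable_EFinP.
pose D := box (fun _ : 'I_m => `[0, 1] : set T).
have mD : measurable D by exact: measurable_box.
have D1 : iid Q m D = 1%E.
  by rewrite iid_box// big1// => i _; exact: uniform_prob_itv01.
exists (~` D); split; first exact: measurableC.
  rewrite [LHS](probability_setC (iid Q m)) //.
  by rewrite [X in (_ - X)%E]D1 subee.
move=> v /= Nv Dv; apply: Nv => _; rewrite lee_fin; apply: fB => i.
by have := Dv i; rewrite /= in_itv.
Qed.

Variable m : nat.
Implicit Types (s : 'cV[R]_m) (sigma : {perm 'I_m}).

Lemma integral_round_law (gamma : R) (f : round_sample R m -> \bar R) :
  0 <= gamma <= 1 -> measurable_fun setT f -> (forall rho, 0 <= f rho)%E ->
  (\int[round_law m gamma]_rho f rho =
   (1 - gamma)%:E * \int[iid Q m]_v f (false, v) +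
   gamma%:E * \int[iid Q m]_v f (true, v))%E.
Proof.
move=> g01 mf f0.
rewrite [LHS]fubini_tonelli1// /fubini_F integral_bernoulli_prob//.
  by rewrite addeC.
by move=> b; apply: integral_ge0.
Qed.

Lemma measurable_argsort_played s sigma :
  measurable [set rho | argsort (played_score s rho) = sigma].
Proof.
have -> : [set rho | argsort (played_score s rho) = sigma] =
   ([set true] `*` [set v : m.-tuple T | argsort (col v : 'cV[R]_m) = sigma]) `|`
   ([set false] `*` (if argsort s == sigma then setT else set0)).
  apply/seteqP; split=> [[[] v]/= H|[b v] /=]; [by left|right|].
    by split=> //=; rewrite H eqxx.
  by case=> -[] ->//=; rewrite /played_score/=; case: eqP.
apply: measurableU; apply: measurableX => //; first exact: measurable_argsort.
by case: ifP.
Qed.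

Lemma integral_argsort_played (gamma : R) s (g : {perm 'I_m} -> R) :
  0 <= gamma <= 1 -> (forall sigma, 0 <= g sigma) ->
  (\int[round_law m gamma]_rho (g (argsort (played_score s rho)))%:E =
   (\sum_sigma rank_prob gamma s sigma * g sigma)%:E)%E.
Proof.
move=> g01 g0; rewrite integral_round_law//; last 2 first.
- apply/measurable_EFinP.
  apply: (@measurable_fun_finite_factor _ _ _ _ _
    (fun rho => argsort (played_score s rho)) g).
  exact: measurable_argsort_played.
- by move=> rho; rewrite lee_fin.
rewrite /played_score /= integral_cst//.
rewrite [X in (_ * (_ * X))%E](probability_setT (iid Q m)) mule1.
rewrite (@integral_finite_factor _ _ _ _ _
  (fun v : m.-tuple T => argsort (col v : 'cV[R]_m)))//; last first.
  by move=> sigma; exact: measurable_argsort.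
rewrite (eq_bigr (fun sigma => (g sigma / m`!%:R)%:E)) => [|sigma _]; last first.
  rewrite [X in (_ * X)%E]iid_argsort//; exact: uniform_prob_set1.
rewrite sumEFin -!EFinM -EFinD; congr EFin.
under [RHS]eq_bigr do rewrite /rank_prob mulrDl.
rewrite big_split/= [X in _ = X + _](bigD1 (argsort s))//= eqxx mulr1.
rewrite [X in _ = _ + X + _]big1 ?addr0; last first.
  by move=> sigma /negbTE ->; rewrite mulr0 mul0r.
rewrite mulr_sumr; congr (_ + _); apply: eq_bigr => sigma _.
by rewrite mulrA mulrAC.
Qed.

End RoundLaw.

(** * Euclidean geometry and the projection *)

Section Euclidean.
Variable R : realType.

Definition dot n (u v : 'cV[R]_n) : R := \sum_i u i 0 * v i 0.

Lemma dotC n (u v : 'cV[R]_n) : dot u v = dot v u.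
Proof. by apply: eq_bigr => i _; rewrite mulrC. Qed.

Lemma dotDl n (u v w : 'cV[R]_n) : dot (u + v) w = dot u w + dot v w.
Proof. by rewrite -big_split; apply: eq_bigr => i _; rewrite mxE mulrDl. Qed.

Lemma dotZl n a (u v : 'cV[R]_n) : dot (a *: u) v = a * dot u v.
Proof. by rewrite mulr_sumr; apply: eq_bigr => i _; rewrite mxE mulrA. Qed.

Lemma dotBl n (u v w : 'cV[R]_n) : dot (u - v) w = dot u w - dot v w.
Proof. by rewrite dotDl -scaleN1r dotZl mulN1r. Qed.

Lemma dotBr n (u v w : 'cV[R]_n) : dot w (u - v) = dot w u - dot w v.
Proof. by rewrite dotC dotBl !(dotC _ w). Qed.

Lemma dotZr n a (u v : 'cV[R]_n) : dot u (a *: v) = a * dot u v.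
Proof. by rewrite dotC dotZl dotC. Qed.

Lemma dot_basis n i (v : 'cV[R]_n) : dot (Defs.basis R i) v = v i 0.
Proof.
rewrite /dot (bigD1 i)//= big1 ?addr0 => [|j /negbTE ji].
  by rewrite mxE !eqxx mul1r.
by rewrite mxE ji mul0r.
Qed.

Lemma dot_adjoint m d (X : 'M[R]_(m, d)) (v : 'cV[R]_m) (w : 'cV[R]_d) :
  dot (X^T *m v) w = dot v (X *m w).
Proof.
have dotE n (a b : 'cV[R]_n) : dot a b = (a^T *m b) 0 0.
  by rewrite mxE; apply: eq_bigr => i _; rewrite mxE.
by rewrite !dotE trmx_mul trmxK mulmxA.
Qed.

Lemma l2norm_sqr n (v : 'cV[R]_n) : l2norm v ^+ 2 = dot v v.
Proof.
rewrite sqr_sqrtr; last by apply: sumr_ge0 => i _; exact: sqr_ge0.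
by apply: eq_bigr => i _; rewrite expr2.
Qed.

Lemma l2norm_ge0 n (v : 'cV[R]_n) : 0 <= l2norm v.
Proof. exact: sqrtr_ge0. Qed.

(** Lagrange's identity: both sides become double sums, the right one symmetrised in [i] and [j],
    and the termwise gap is half of [(u i * v j - u j * v i) ^+ 2]. *)
Lemma cauchy_schwarz n (u v : 'cV[R]_n) : `|dot u v| <= l2norm u * l2norm v.
Proof.
rewrite -(@ler_pXn2r _ 2)// ?nnegrE ?mulr_ge0 ?l2norm_ge0//.
rewrite exprMn !l2norm_sqr real_normK ?num_real// expr2.
have -> : dot u u * dot v v =
    2^-1 * (\sum_i \sum_j (u i 0 ^+ 2 * v j 0 ^+ 2 + u j 0 ^+ 2 * v i 0 ^+ 2)).
  under eq_bigr do rewrite big_split.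
  rewrite big_split /= [X in _ * (_ + X)]exchange_big /=.
  have -> : \sum_i \sum_j u i 0 ^+ 2 * v j 0 ^+ 2 = dot u u * dot v v.
    by rewrite big_distrlr; apply: eq_bigr => i _; apply: eq_bigr => j _.
  by field.
rewrite big_distrlr mulr_sumr; apply: ler_sum => i _.
rewrite mulr_sumr; apply: ler_sum => j _ /=.
by have := sqr_ge0 (u i 0 * v j 0 - u j 0 * v i 0); lra.
Qed.

Lemma mulmx_colE m d (X : 'M[R]_(m, d)) (w : 'cV[R]_d) i :
  (X *m w) i 0 = dot (row i X)^T w.
Proof. by rewrite mxE; apply: eq_bigr => k _; rewrite !mxE. Qed.

(** [X^T *m v] combines the rows of [X] with coefficients [v i]. In the proof, [l2norm z ^+ 2] is
    moved across the adjoint to [dot v (X *m z)], bounded row by row, and divided by [l2norm z]. *)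
Lemma l2norm_trmx_mul_le m d (X : 'M[R]_(m, d)) (v : 'cV[R]_m) (RD : R) :
  (forall i, l2norm (row i X)^T <= RD) ->
  l2norm (X^T *m v) ^+ 2 <= (RD * \sum_i `|v i 0|) ^+ 2.
Proof.
move=> XRD.
set z := X^T *m v; have z0 := l2norm_ge0 z.
have zz : l2norm z ^+ 2 <= RD * (\sum_i `|v i 0|) * l2norm z.
  rewrite l2norm_sqr dot_adjoint mulr_sumr mulr_suml.
  apply: ler_sum => i _; apply: le_trans (ler_norm _) _.
  rewrite normrM mulmx_colE [RD * _]mulrC -mulrA ler_wpM2l//.
  by apply: le_trans (cauchy_schwarz _ _) _; rewrite ler_wpM2r.
have [->|zN0] := eqVneq (l2norm z) 0; first by rewrite expr0n/= sqr_ge0.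
have zle : l2norm z <= RD * \sum_i `|v i 0|.
  by rewrite -(@ler_pM2r _ (l2norm z)) -?expr2// lt_neqAle eq_sym zN0.
by rewrite ler_sqr ?nnegrE// (le_trans z0).
Qed.

Lemma score_norm_le m d (X : 'M[R]_(m, d)) (w : 'cV[R]_d) (RD U : R) i :
  (forall i, l2norm (row i X)^T <= RD) -> l2norm w <= U ->
  `|(X *m w) i 0| <= RD * U.
Proof.
move=> XRD wU; rewrite mulmx_colE.
by apply: le_trans (cauchy_schwarz _ _) _; rewrite ler_pM ?l2norm_ge0.
Qed.

Lemma l2norm0 n : l2norm (0 : 'cV[R]_n) = 0.
Proof.
by rewrite /l2norm big1 ?sqrtr0// => i _; rewrite mxE expr0n.
Qed.

Lemma l2normZ n a (v : 'cV[R]_n) : 0 <= a -> l2norm (a *: v) = a * l2norm v.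
Proof.
move=> a0; apply/eqP; rewrite -(@eqrXn2 _ 2) ?mulr_ge0 ?l2norm_ge0//.
by rewrite exprMn !l2norm_sqr dotZl dotZr mulrA expr2.
Qed.

Lemma l2norm_project n (U : R) (v : 'cV[R]_n) : 0 < U -> l2norm (project U v) <= U.
Proof.
move=> U0; have v0 := l2norm_ge0 v.
rewrite l2normZ; last by rewrite le_min ler01 divr_ge0// ltW.
have [->|vN0] := eqVneq (l2norm v) 0; first by rewrite mulr0 ltW.
rewrite -ler_pdivlMr; first by rewrite ge_min lexx orbT.
by rewrite lt_neqAle eq_sym vN0.
Qed.

Lemma project_dist n (U : R) (v u : 'cV[R]_n) : 0 < U -> l2norm u <= U ->
  l2norm (project U v - u) ^+ 2 <= l2norm (v - u) ^+ 2.
Proof.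
move=> U0 uU; have v0 := l2norm_ge0 v; have u0 := l2norm_ge0 u.
rewrite /project; have [vU|Uv] := leP (l2norm v) U.
  (* Here [U / 0 = 0] makes the scaling factor [0] instead of [1], so [v = 0] is treated apart. *)
  have [vn0|vp] := eqVneq (l2norm v) 0.
    have v_eq0 : v = 0.
      apply/colP => i; rewrite mxE; apply/eqP.
      have := l2norm_sqr v; rewrite vn0 expr0n/= => /esym/eqP.
      rewrite psumr_eq0 => [/allP/(_ i)|j _]; last exact: sqr_ge0.
      by rewrite mem_index_enum mulf_eq0 orbb; apply.
    by rewrite v_eq0 scaler0.
  rewrite min_l ?scale1r// ler_pdivlMr ?mul1r//.
  by rewrite lt_neqAle eq_sym vp.
have vp : 0 < l2norm v by exact: lt_trans Uv.
rewrite min_r; last by rewrite ler_pdivrMr ?mul1r// ltW.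
set c := U / l2norm v.
have c0 : 0 < c by rewrite divr_gt0.
have c1 : c <= 1 by rewrite ler_pdivrMr ?mul1r// ltW.
have cv : c * l2norm v = U by rewrite mulfVK// gt_eqF.
have uv : dot v u <= l2norm v * U.
  apply: le_trans (ler_norm _) _; apply: le_trans (cauchy_schwarz _ _) _.
  by rewrite ler_wpM2l.
rewrite !l2norm_sqr !dotBl !dotBr !dotZl !dotZr !(dotC u) -!l2norm_sqr.
(* This product is exactly the difference of the two squared distances. Its second factor is
   nonnegative because [dot v u <= l2norm v * U = c * l2norm v ^+ 2] and [2 * c <= 1 + c]. *)
suff : 0 <= (1 - c) * ((1 + c) * l2norm v ^+ 2 - 2 * dot v u) by lra.
apply: mulr_ge0; first lra.
rewrite subr_ge0; apply: (@le_trans _ _ (2 * c * l2norm v ^+ 2)).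
  by rewrite expr2 mulrA -[_ * c * _]mulrA cv -mulrA ler_wpM2l// mulrC.
by rewrite ler_wpM2r ?sqr_ge0//; lra.
Qed.

End Euclidean.

(** * Prefixes of random rankings *)

Section RankProb.
Variables (R : realType) (m : nat).
Implicit Types (s : 'cV[R]_m) (sigma tau : {perm 'I_m}) (gamma : R).

Lemma rank_prob_ge gamma s sigma : gamma <= 1 ->
  gamma / m`!%:R <= rank_prob gamma s sigma.
Proof.
by move=> g1; rewrite /rank_prob lerDr mulr_ge0 ?subr_ge0// ler0n.
Qed.

Lemma rank_prob_ge0 gamma s sigma : 0 <= gamma <= 1 ->
  0 <= rank_prob gamma s sigma.
Proof.
case/andP=> g0 g1; apply: le_trans (rank_prob_ge s sigma g1).
by rewrite divr_ge0 ?ler0n.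
Qed.

Lemma sum_rank_prob gamma s : \sum_sigma rank_prob gamma s sigma = 1.
Proof.
rewrite big_split/= -mulr_sumr (bigD1 (argsort s))//= eqxx big1 ?addr0; last first.
  by move=> sigma /negbTE ->.
rewrite mulr1 sumr_const card_Sn -[_ *+ m`!]mulr_natr divfK ?subrK//.
Qed.

Lemma size_top k sigma : (k <= m)%N -> size (top k sigma) = k.
Proof. by move=> km; rewrite size_take size_map size_enum_ord; case: ltngtP km. Qed.

Lemma top_uniq k sigma : uniq (top k sigma).
Proof. by rewrite take_uniq// map_inj_uniq ?enum_uniq//; exact: perm_inj. Qed.

Lemma topM k sigma tau : top k (sigma * tau)%g = map tau (top k sigma).
Proof.
by rewrite /top map_take -map_comp; congr take; apply: eq_map => i /=; rewrite permM.
Qed.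

(** The symmetric group is [k]-transitive, so every prefix of length [k] is shared
    by the same number of rankings. *)
Lemma card_top_ge k (js : k.-tuple 'I_m) : uniq js ->
  (m`! <= m ^ k * #|[set sigma | top k sigma == js]|)%N.
Proof.
move=> js_uniq.
have km : (k <= m)%N 
  by rewrite -(size_tuple js) -(card_uniqP js_uniq) -[m in (_ <= m)%N]card_ord max_card.
pose N (t : k.-tuple 'I_m) := #|[set sigma | top k sigma == t]|.
have Nle t : (N t <= N js)%N.
  have [tu|/negP tN] := boolP (uniq t); last first.
    rewrite /N (_ : [set _ | _] = finset.set0) ?cards0//.
    apply/setP => sigma; rewrite !inE.
    by apply/negP => /eqP e; apply: tN; rewrite -e top_uniq.
  have tr : [transitive^k 'Sym_('I_m), on [set: 'I_m] | 'P]%act.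
    by apply: (ntransitive_weak _ (Sym_trans 'I_m)); rewrite card_ord.
  have mem (u : k.-tuple 'I_m) : uniq u -> u \in dtuple_on k [set: 'I_m].
    by move=> uu; rewrite inE uu; apply/fintype.subsetP => i _; rewrite inE.
  have [tau _ tE] := atransP2 tr (mem _ tu) (mem _ js_uniq).
  rewrite {1}/N -(card_imset _ (mulIg tau)); apply: subset_leq_card.
  apply/fintype.subsetP => x /imsetP[sigma + ->]; rewrite !inE => /eqP st.
  rewrite topM st tE /=; apply/eqP; exact: eq_map.
rewrite -card_Sn -[X in (X <= _)%N]sum1_card.
(* The [m!] rankings are classified by their prefix, one of [m ^ k] tuples, and no class is larger
   than that of [js]. *)
pose h sigma : k.-tuple 'I_m := tcast (size_top sigma km) (in_tuple (top k sigma)).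
rewrite (partition_big h xpredT)//=.
apply: (@leq_trans (\sum_(t : k.-tuple 'I_m) N js)%N).
  apply: leq_sum => t _; apply: leq_trans (Nle t).
  rewrite /N -sum1_card; apply/eq_leq/eq_bigl => sigma.
  by rewrite inE /h -val_eqE /= val_tcast.
by rewrite sum_nat_const card_tuple card_ord.
Qed.

(** Exploration alone gives every ranking mass [gamma / m!], and at least [m! / m ^ k] rankings
    share the prefix. *)
Lemma top_prob_ge gamma s (js : seq 'I_m) : 0 <= gamma <= 1 -> uniq js ->
  gamma / m%:R ^+ size js <= top_prob gamma s js.
Proof.
case/andP=> g0 g1 jsu.
have mf : 0 < m`!%:R :> R by rewrite ltr0n fact_gt0.
have [->|mn0] := eqVneq (m%:R ^+ size js : R) 0.
  by rewrite invr0 mulr0 sumr_ge0// => sigma _; rewrite rank_prob_ge0 ?g0.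
have mp : 0 < m%:R ^+ size js :> R by rewrite lt_neqAle eq_sym mn0 exprn_ge0.
apply: (@le_trans _ _ (\sum_(sigma | top (size js) sigma == js) gamma / m`!%:R)); last first.
  by apply: ler_sum => sigma _; exact: rank_prob_ge.
rewrite sumr_const -mulrnAr ler_wpM2l// -[leRHS]mulr_natr.
rewrite ler_pdivlMl// ler_pdivrMr// -natrX -natrM ler_nat mulnC.
by have := @card_top_ge _ (in_tuple js) jsu; rewrite cardsE.
Qed.

End RankProb.

(** * Gradient estimators *)

Section L1.
Variables (R : realType) (m : nat).
Implicit Types u v : 'cV[R]_m.

Definition l1norm v : R := \sum_i `|v i 0|.

Lemma l1norm_ge0 v : 0 <= l1norm v.
Proof. exact: sumr_ge0. Qed.

Lemma l1normD u v : l1norm (u + v) <= l1norm u + l1norm v.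
Proof. by rewrite -big_split; apply: ler_sum => i _; rewrite mxE ler_normD. Qed.

Lemma l1normZ a v : l1norm (a *: v) = `|a| * l1norm v.
Proof. by rewrite mulr_sumr; apply: eq_bigr => i _; rewrite mxE normrM. Qed.

Lemma l1normB u v : l1norm (u - v) <= l1norm u + l1norm v.
Proof. by apply: le_trans (l1normD _ _) _; rewrite -scaleN1r l1normZ normrN1 mul1r. Qed.

Lemma l1norm_basis i : l1norm (Defs.basis R i) = 1.
Proof.
rewrite /l1norm (bigD1 i)//= big1 ?addr0 => [|j /negbTE ji].
  by rewrite mxE !eqxx normr1.
by rewrite mxE ji normr0.
Qed.

End L1.

Section TopSums.
Variables (R : realType) (gamma : R).

Lemma top1 n (sigma : {perm 'I_n.+1}) : top 1 sigma = [:: sigma ord0].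
Proof. by rewrite /top enum_ordSl /= take0. Qed.

Lemma top2 n (sigma : {perm 'I_n.+2}) :
  top 2 sigma = [:: sigma ord0; sigma (lift ord0 ord0)].
Proof. by rewrite /top !enum_ordSl /= take0. Qed.

Lemma sum_rank_prob_top1 n (s : 'cV[R]_n.+1) (F : 'I_n.+1 -> R) :
  \sum_sigma rank_prob gamma s sigma * F (sigma ord0) =
  \sum_j top_prob gamma s [:: j] * F j.
Proof.
rewrite (partition_big (fun sigma : {perm 'I_n.+1} => sigma ord0) xpredT)//=.
apply: eq_bigr => j _; rewrite mulr_suml; apply: eq_big => [sigma|sigma /eqP <-//].
by rewrite top1 eqseq_cons andbT.
Qed.

Lemma sum_rank_prob_top2 n (s : 'cV[R]_n.+2) (F : 'I_n.+2 -> 'I_n.+2 -> R) :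
  \sum_sigma rank_prob gamma s sigma * F (sigma ord0) (sigma (lift ord0 ord0)) =
  \sum_i \sum_(j | i != j) top_prob gamma s [:: i; j] * F i j.
Proof.
rewrite pair_big_dep/=.
rewrite (partition_big
  (fun sigma : {perm 'I_n.+2} => (sigma ord0, sigma (lift ord0 ord0)))
  (fun p => p.1 != p.2))/=; last by move=> sigma _; rewrite (inj_eq perm_inj).
apply: eq_bigr => -[i j] _ /=; rewrite mulr_suml.
apply: eq_big => [sigma|sigma /eqP[<- <-]//].
by rewrite top2 !eqseq_cons andbT xpair_eqE.
Qed.

Lemma sum_top_prob1 n (s : 'cV[R]_n.+1) : \sum_j top_prob gamma s [:: j] = 1.
Proof.
rewrite -(sum_rank_prob gamma s).
under [RHS]eq_bigr do rewrite -[rank_prob _ _ _]mulr1.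
by rewrite (sum_rank_prob_top1 s (fun=> 1)); apply: eq_bigr => j _; rewrite mulr1.
Qed.

Hypothesis g01 : 0 < gamma <= 1.

Let g01' : 0 <= gamma <= 1. Proof. by case/andP: g01 => /ltW ->. Qed.

Lemma top_prob_gt0 n (s : 'cV[R]_n.+1) js : uniq js -> 0 < top_prob gamma s js.
Proof.
move=> jsu; apply: lt_le_trans (top_prob_ge s g01' jsu).
by case/andP: g01 => g0 _; rewrite divr_gt0// exprn_gt0// ltr0n.
Qed.

Lemma invr_top_prob_le n (s : 'cV[R]_n.+1) js : uniq js ->
  (top_prob gamma s js)^-1 <= n.+1%:R ^+ size js / gamma.
Proof.
move=> jsu; have p0 := top_prob_gt0 s jsu.
case/andP: g01 => g0 _.
have := top_prob_ge s g01' jsu.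
rewrite -[_ / gamma]invrK lef_pV2 ?posrE//; last first.
  by rewrite invr_gt0 divr_gt0// exprn_gt0// ltr0n.
by rewrite invf_div.
Qed.

End TopSums.

Section Estimators.
Variables (R : realType) (gamma : R).
Hypothesis g01 : 0 < gamma <= 1.

(** Inverse-probability weighting: the term for document [j] is divided by the probability of seeing
    [j] first, and the average restores it. The part in [s], known to the learner, is averaged with
    total mass one. *)
Lemma sq_unbiased n (s v : 'cV[R]_n.+1) (lab : 'I_n.+1 -> nat) :
  \sum_sigma rank_prob gamma s sigma *
     dot (score_estimator Sq gamma s (feedback 1 sigma lab)) v =
  \sum_i 2 * (s i 0 - (lab i)%:R) * v i 0.
Proof.
pose F j := 2 * (dot s v - (lab j)%:R / top_prob gamma s [:: j] * v j 0).
under eq_bigr => sigma _.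
  rewrite /feedback top1 /= dotZl dotBl dotZl dot_basis -/(F (sigma ord0)); over.
rewrite sum_rank_prob_top1 /F.
under eq_bigr => j _.
  rewrite (_ : _ * _ = top_prob gamma s [:: j] * (2 * dot s v) - 2 * (lab j)%:R * v j 0).
    over.
  by field; rewrite gt_eqF// top_prob_gt0.
rewrite big_split/= -mulr_suml sum_top_prob1 mul1r sumrN /dot mulr_sumr -sumrB.
by apply: eq_bigr => i _; ring.
Qed.

Lemma KL_unbiased n (s v : 'cV[R]_n.+1) (lab : 'I_n.+1 -> nat) :
  \sum_sigma rank_prob gamma s sigma *
     dot (score_estimator KL gamma s (feedback 1 sigma lab)) v =
  \sum_i (expR (s i 0) - expR (lab i)%:R) * v i 0.
Proof.
pose F j := (expR (s j 0) - expR (lab j)%:R) / top_prob gamma s [:: j] * v j 0.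
under eq_bigr => sigma _.
  rewrite /feedback top1 /= dotZl dot_basis -/(F (sigma ord0)); over.
rewrite sum_rank_prob_top1 /F; apply: eq_bigr => j _.
by field; rewrite gt_eqF// top_prob_gt0.
Qed.

Lemma dot_svm_dir n (s v : 'cV[R]_n) i j ri rj :
  dot (svm_dir s i j ri rj) v =
  (rj < ri)%N%:R * (s i 0 < 1 + s j 0)%R%:R * (v j 0 - v i 0).
Proof. by rewrite dotZl dotBl !dot_basis. Qed.

(** Swapping the names of the two top documents pairs [p i j * H j i] with
    [p j i * H i j], and the denominators cancel. *)
Lemma svm_unbiased n (s v : 'cV[R]_n.+2) (lab : 'I_n.+2 -> nat) :
  \sum_sigma rank_prob gamma s sigma *
     dot (score_estimator Svm gamma s (feedback 2 sigma lab)) v =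
  \sum_i \sum_(j | i != j) dot (svm_dir s i j (lab i) (lab j)) v.
Proof.
pose H i j := dot (svm_dir s i j (lab i) (lab j)) v.
pose p i j := top_prob gamma s [:: i; j].
pose F i j := (p i j + p j i)^-1 * (H i j + H j i).
under eq_bigr => sigma _.
  rewrite /feedback top2 /= dotZl dotDl -/(F (sigma ord0) (sigma (lift ord0 ord0))); over.
rewrite sum_rank_prob_top2.
have pgt0 i j : i != j -> 0 < p i j.
  by move=> ij; apply: top_prob_gt0 => //=; rewrite inE ij.
transitivity (\sum_i \sum_(j | i != j) p i j / (p i j + p j i) * H i j +
              \sum_i \sum_(j | i != j) p i j / (p i j + p j i) * H j i).
  rewrite -big_split; apply: eq_bigr => i _; rewrite -big_split.
  by apply: eq_bigr => j _; rewrite /F mulrA mulrDr.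
rewrite [X in _ + X](exchange_big_dep xpredT)//= -big_split; apply: eq_bigr => i _ /=.
rewrite [X in _ + X](eq_bigl (fun j => i != j)); last by move=> j; rewrite eq_sym.
rewrite -big_split; apply: eq_bigr => j ij /=.
rewrite [p j i + _]addrC -mulrDl -mulrDl divff ?mul1r// gt_eqF// addr_gt0//; apply: pgt0 => //.
by rewrite eq_sym.
Qed.

(** Coordinatewise the gap is the square of [s i 0 - s' i 0]. *)
Lemma sq_gradient n (s s' : 'cV[R]_n) (lab : 'I_n -> nat) :
  phi_sq s lab - phi_sq s' lab <=
  \sum_i 2 * (s i 0 - (lab i)%:R) * (s - s') i 0.
Proof.
rewrite /phi_sq !l2norm_sqr -sumrB; apply: ler_sum => i _; rewrite !mxE.
by have := sqr_ge0 (s i 0 - s' i 0); lra.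
Qed.

(** Each summand is the Bregman divergence of the exponential, [exp s - exp r - exp r (s - r)]. This
    separable form is the one used for convexity, nonnegativity and measurability. *)
Lemma phi_KLE n (s : 'cV[R]_n) (lab : 'I_n -> nat) :
  phi_KL s lab = \sum_i (expR (lab i)%:R * ((lab i)%:R - s i 0 - 1) + expR (s i 0)).
Proof.
rewrite /phi_KL -!sumrB -big_split; apply: eq_bigr => i _ /=.
by rewrite !expRK; ring.
Qed.

Lemma KL_gradient n (s s' : 'cV[R]_n) (lab : 'I_n -> nat) :
  phi_KL s lab - phi_KL s' lab <=
  \sum_i (expR (s i 0) - expR (lab i)%:R) * (s - s') i 0.
Proof.
have -> : phi_KL s lab - phi_KL s' lab =
    \sum_i (expR (lab i)%:R * (s' i 0 - s i 0) + (expR (s i 0) - expR (s' i 0))).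
  rewrite !phi_KLE -sumrB; apply: eq_bigr => i _; ring.
apply: ler_sum => i _; rewrite !mxE.
have := expR_ge1Dx (s' i 0 - s i 0).
rewrite expRD expRN => H.
have e0 := expR_gt0 (s i 0).
(* The exponential lies above its tangent at [s i 0]. *)
have : expR (s i 0) * (1 + (s' i 0 - s i 0)) <= expR (s' i 0).
  by rewrite mulrC -ler_pdivlMr.
by lra.
Qed.

(** Pair by pair, a subgradient of the hinge: slope of the active branch when the margin is
    violated, and slope [0] otherwise, the kink included because the test in [svm_dir] is strict. *)
Lemma svm_gradient n (s s' : 'cV[R]_n) (lab : 'I_n -> nat) :
  phi_svm s lab - phi_svm s' lab <=
  \sum_i \sum_(j | i != j) dot (svm_dir s i j (lab i) (lab j)) (s - s').
Proof.
rewrite /phi_svm -sumrB; apply: ler_sum => i _; rewrite -sumrB; apply: ler_sum => j _.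
rewrite dot_svm_dir !mxE -mulrBr -mulrA ler_wpM2l ?ler0n//.
have [ij|ij] := ltP (s i 0) (1 + s j 0).
  rewrite max_r; last lra.
  have : 1 + s' j 0 - s' i 0 <= Num.max 0 (1 + s' j 0 - s' i 0).
    by rewrite le_max lexx orbT.
  by rewrite /=; lra.
rewrite max_l; last lra.
have : 0 <= Num.max 0 (1 + s' j 0 - s' i 0) by rewrite le_max lexx.
by rewrite /=; lra.
Qed.

(** Convexity and unbiasedness combined. Gradient descent uses the surrogate only through this
    inequality, so the nondifferentiable hinge is covered too. Splitting on [m] exposes the
    [topk phi] documents that the estimator reads. *)
Lemma surrogate_gradient phi m (s s' : 'cV[R]_m) (lab : 'I_m -> nat) :
  (topk phi <= m)%N ->
  surrogate_loss phi s lab - surrogate_loss phi s' lab <=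
  \sum_sigma rank_prob gamma s sigma *
    dot (score_estimator phi gamma s (feedback (topk phi) sigma lab)) (s - s').
Proof.
case: phi => /= km.
- case: m km s s' lab => // m _ s s' lab.
  by rewrite sq_unbiased; exact: sq_gradient.
- case: m km s s' lab => // -[//|m] _ s s' lab.
  by rewrite svm_unbiased; exact: svm_gradient.
- case: m km s s' lab => // m _ s s' lab.
  by rewrite KL_unbiased; exact: KL_gradient.
Qed.

End Estimators.

(** * Explicit constants and bounds on the surrogates *)

Section Constants.
Variable R : realType.

(** [RD ^+ 2] times the [l1] moment bounds proved below, with [RD * U] as bound on the scores. *)
Definition moment_const (phi : surrogate) (RD : R) (m : nat) (U : R) (Rmax : nat) : R :=
  match phi with
  | Sq => 8 * RD ^+ 4 * m%:R ^+ 2 * U ^+ 2 + 8 * RD ^+ 2 * m%:R ^+ 2 * Rmax%:R ^+ 2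
  | Svm => 16 * RD ^+ 2 * m%:R ^+ 4
  | KL => 2 * RD ^+ 2 * m%:R ^+ 2 * expR (RD * U) ^+ 2
          + 2 * RD ^+ 2 * m%:R ^+ 2 * expR Rmax%:R ^+ 2
  end.

(** For scores in the unit interval: [(s - r)^2 <= 1 + Rmax^2] since the cross term is nonpositive,
    each hinge is at most [2], and [exp r (r - s - 1) + exp s <= Rmax exp Rmax + exp 1]. *)
Definition explore_const (phi : surrogate) (m Rmax : nat) : R :=
  match phi with
  | Sq => m%:R + m%:R * Rmax%:R ^+ 2
  | Svm => 2 * m%:R ^+ 2
  | KL => m%:R * Rmax%:R * expR Rmax%:R + expR 1 * m%:R
  end.

Lemma moment_const_ge0 phi RD m U Rmax :
  0 <= RD -> 0 <= U -> 0 <= moment_const phi RD m U Rmax.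
Proof.
move=> RD0 U0; have e x := ltW (expR_gt0 (x : R)).
by case: phi => /=; rewrite ?addr_ge0// ?mulr_ge0 ?exprn_ge0 ?ler0n.
Qed.

Lemma explore_const_ge0 phi m Rmax : 0 <= explore_const phi m Rmax.
Proof.
have e x := ltW (expR_gt0 (x : R)).
by case: phi => /=; rewrite ?addr_ge0// ?mulr_ge0 ?exprn_ge0 ?ler0n.
Qed.

End Constants.

Section LossBounds.
Variables (R : realType) (m : nat).
Implicit Types (s : 'cV[R]_m) (lab : 'I_m -> nat).

Lemma surrogate_loss_ge0 phi s lab : 0 <= surrogate_loss phi s lab.
Proof.
case: phi => /=; first exact: sqr_ge0.
  apply: sumr_ge0 => i _; apply: sumr_ge0 => j _.
  by rewrite mulr_ge0 ?ler0n// le_max lexx.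
rewrite phi_KLE; apply: sumr_ge0 => i _.
(* The tangent of the exponential at the label bounds the divergence below by [0]. *)
have := expR_ge1Dx (s i 0 - (lab i)%:R).
rewrite expRD expRN => H.
have e0 := expR_gt0 ((lab i)%:R : R).
have : expR (lab i)%:R * (1 + (s i 0 - (lab i)%:R)) <= expR (s i 0).
  by rewrite mulrC -ler_pdivlMr.
by lra.
Qed.

Lemma surrogate_loss_le phi s lab Rmax :
  (forall i, 0 <= s i 0 <= 1) -> (forall i, (lab i <= Rmax)%N) ->
  surrogate_loss phi s lab <= explore_const R phi m Rmax.
Proof.
move=> s01 labR.
have sum_const (c : R) : \sum_(i < m) c = m%:R * c.
  by rewrite sumr_const card_ord mulr_natl.
case: phi => /=.
- rewrite /phi_sq l2norm_sqr -[X in _ <= X + _]mulr1 -mulrDr -sum_const.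
  apply: ler_sum => i _; rewrite !mxE -expr2.
  have /andP[s0 s1] := s01 i.
  have r0 : 0 <= (lab i)%:R :> R by rewrite ler0n.
  have r1 : (lab i)%:R <= Rmax%:R :> R by rewrite ler_nat.
  by nra.
- rewrite (_ : 2 * m%:R ^+ 2 = m%:R * (m%:R * 2)); last by ring.
  rewrite -2!sum_const; apply: ler_sum => i _.
  apply: (@le_trans _ _ (\sum_(j | i != j) 2)); last first.
    by rewrite [leRHS](bigID (fun j => i != j))/= lerDl sumr_ge0.
  apply: ler_sum => j _.
  have /andP[s0 s1] := s01 i; have /andP[t0 t1] := s01 j.
  apply: (@le_trans _ _ (1 * 2)); last by rewrite mul1r.
  apply: ler_pM; rewrite ?ler0n ?ler1n ?le_max ?lexx//.
    by case: (_ < _)%N.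
  by rewrite ge_max; apply/andP; split; lra.
- rewrite phi_KLE -mulrA [expR 1 * _]mulrC -mulrDr -sum_const.
  apply: ler_sum => i _.
  have /andP[s0 s1] := s01 i.
  have r0 : 0 <= (lab i)%:R :> R by rewrite ler0n.
  have r1 : (lab i)%:R <= Rmax%:R :> R by rewrite ler_nat.
  have e0 := expR_gt0 ((lab i)%:R : R).
  have e1 : expR (lab i)%:R <= expR Rmax%:R :> R by rewrite ler_expR.
  have e2 : expR (s i 0) <= expR 1 by rewrite ler_expR.
  apply: lerD => //; rewrite mulrC; apply: (@le_trans _ _ ((lab i)%:R * expR (lab i)%:R)).
    by rewrite ler_wpM2r ?(ltW e0)//; lra.
  by apply: ler_pM => //; exact: ltW.
Qed.

End LossBounds.

(** * Second moments of the estimators *)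

Section Moments.
Variables (R : realType) (gamma : R).
Hypothesis g01 : 0 < gamma <= 1.

Let g0 : 0 < gamma. Proof. by case/andP: g01. Qed.

Lemma svm_dir_l1norm n (s : 'cV[R]_n) i j ri rj : l1norm (svm_dir s i j ri rj) <= 2.
Proof.
rewrite l1normZ; apply: (@le_trans _ _ (1 * (1 + 1))); last by rewrite mul1r.
apply: ler_pM; rewrite ?normr_ge0 ?l1norm_ge0//.
  by rewrite -natrM normr_nat lern1; case: (rj < ri)%N; case: (_ < _)%R.
by apply: le_trans (l1normB _ _) _; rewrite !l1norm_basis.
Qed.

Lemma sum_invr_top_prob n (s : 'cV[R]_n.+1) :
  \sum_j (top_prob gamma s [:: j])^-1 <= n.+1%:R ^+ 2 / gamma.
Proof.
apply: (@le_trans _ _ (\sum_(j < n.+1) (n.+1%:R / gamma))).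
  by apply: ler_sum => j _; have := invr_top_prob_le g01 s (isT : uniq [:: j]); rewrite expr1.
by rewrite sumr_const card_ord -[(_ / _) *+ _]mulr_natl expr2 mulrA.
Qed.

Lemma sq_l1_moment n (s : 'cV[R]_n.+1) (lab : 'I_n.+1 -> nat) A Rmax :
  (forall i, `|s i 0| <= A) -> (forall i, (lab i <= Rmax)%N) ->
  \sum_sigma rank_prob gamma s sigma *
    l1norm (score_estimator Sq gamma s (feedback 1 sigma lab)) ^+ 2 <=
  (8 * n.+1%:R ^+ 2 * A ^+ 2 + 8 * n.+1%:R ^+ 2 * Rmax%:R ^+ 2) / gamma.
Proof.
move=> sA labR.
have A0 : 0 <= A by apply: le_trans (sA ord0).
pose F j := l1norm (2%:R *: (s - ((lab j)%:R / top_prob gamma s [:: j]) *: Defs.basis R j)) ^+ 2.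
under eq_bigr => sigma _.
  rewrite /feedback top1 /= -/(F (sigma ord0)); over.
rewrite sum_rank_prob_top1.
apply: (@le_trans _ _ (\sum_j (8 * n.+1%:R ^+ 2 * A ^+ 2 * top_prob gamma s [:: j] +
    8 * Rmax%:R ^+ 2 * (top_prob gamma s [:: j])^-1))).
  apply: ler_sum => j _; set p := top_prob _ _ _.
  have p0 : 0 < p by exact: top_prob_gt0.
  have r0 : 0 <= (lab j)%:R :> R by rewrite ler0n.
  have r1 : (lab j)%:R <= Rmax%:R :> R by rewrite ler_nat.
  have l1s : l1norm s <= n.+1%:R * A.
    apply: (@le_trans _ _ (\sum_(i < n.+1) A)); first by apply: ler_sum => i _; exact: sA.
    by rewrite sumr_const card_ord mulr_natl.
  have Fle : F j <= (2 * (n.+1%:R * A + Rmax%:R / p)) ^+ 2.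
    rewrite ler_sqr ?nnegrE ?l1norm_ge0//; last first.
      by rewrite mulr_ge0// addr_ge0// mulr_ge0// invr_ge0 ltW.
    rewrite l1normZ ger0_norm// ler_wpM2l//; apply: le_trans (l1normB _ _) _.
    apply: lerD => //; rewrite l1normZ l1norm_basis mulr1 ger0_norm ?divr_ge0// ?(ltW p0)//.
    by rewrite ler_wpM2r// invr_ge0 ltW.
  apply: le_trans (ler_wpM2l (ltW p0) Fle) _.
  (* [(a + b)^2 = 2 a^2 + 2 b^2 - (a - b)^2] with [b = Rmax / p]; the outer factor [p] leaves a
     single inverse of [p]. *)
  have -> : p * (2 * (n.+1%:R * A + Rmax%:R / p)) ^+ 2 =
     8 * n.+1%:R ^+ 2 * A ^+ 2 * p + 8 * Rmax%:R ^+ 2 * p^-1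
     - 4 * p * (n.+1%:R * A - Rmax%:R / p) ^+ 2.
    by field; rewrite gt_eqF.
  by rewrite lerBlDr lerDl mulr_ge0 ?sqr_ge0// mulr_ge0// ltW.
rewrite big_split/= -!mulr_sumr sum_top_prob1 mulr1 [leRHS]mulrDl; apply: lerD.
  (* This summand has no inverse probability; it is absorbed because [1 / gamma >= 1]. *)
  rewrite ler_peMr ?mulr_ge0 ?exprn_ge0//.
  by case/andP: g01 => _ g1; rewrite invf_ge1.
have -> : 8 * n.+1%:R ^+ 2 * Rmax%:R ^+ 2 / gamma = 8 * Rmax%:R ^+ 2 * (n.+1%:R ^+ 2 / gamma).
  by ring.
by rewrite ler_wpM2l ?mulr_ge0 ?exprn_ge0// sum_invr_top_prob.
Qed.

Lemma KL_l1_moment n (s : 'cV[R]_n.+1) (lab : 'I_n.+1 -> nat) A Rmax :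
  (forall i, `|s i 0| <= A) -> (forall i, (lab i <= Rmax)%N) ->
  \sum_sigma rank_prob gamma s sigma *
    l1norm (score_estimator KL gamma s (feedback 1 sigma lab)) ^+ 2 <=
  (2 * n.+1%:R ^+ 2 * expR A ^+ 2 + 2 * n.+1%:R ^+ 2 * expR Rmax%:R ^+ 2) / gamma.
Proof.
move=> sA labR.
pose F j := l1norm (((expR (s j 0) - expR (lab j)%:R) / top_prob gamma s [:: j]) *:
  Defs.basis R j) ^+ 2.
under eq_bigr => sigma _.
  rewrite /feedback top1 /= -/(F (sigma ord0)); over.
rewrite sum_rank_prob_top1.
pose E := 2 * expR A ^+ 2 + 2 * expR Rmax%:R ^+ 2 : R.
have E0 : 0 <= E by rewrite addr_ge0// mulr_ge0// exprn_ge0// ltW// expR_gt0.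
apply: (@le_trans _ _ (\sum_j E * (top_prob gamma s [:: j])^-1)).
  apply: ler_sum => j _; set p := top_prob _ _ _.
  have p0 : 0 < p by exact: top_prob_gt0.
  rewrite /F -/p l1normZ l1norm_basis mulr1 real_normK ?num_real//.
  have -> : p * ((expR (s j 0) - expR (lab j)%:R) / p) ^+ 2 =
     (expR (s j 0) - expR (lab j)%:R) ^+ 2 * p^-1 by field; rewrite gt_eqF.
  rewrite ler_wpM2r ?invr_ge0 ?(ltW p0)//.
  have e1 : expR (s j 0) <= expR A.
    by rewrite ler_expR (le_trans (ler_norm _) (sA j)).
  have e2 : expR (lab j)%:R <= expR Rmax%:R :> R by rewrite ler_expR ler_nat.
  have := expR_gt0 (s j 0); have := expR_gt0 ((lab j)%:R : R).
  rewrite /E; move: (expR _) (expR _) (expR _) (expR _) e1 e2 => a b c e ab ce a0 c0.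
  by nra.
rewrite -mulr_sumr.
have -> : (2 * n.+1%:R ^+ 2 * expR A ^+ 2 + 2 * n.+1%:R ^+ 2 * expR Rmax%:R ^+ 2) / gamma
   = E * (n.+1%:R ^+ 2 / gamma) by rewrite /E; ring.
by rewrite ler_wpM2l// sum_invr_top_prob.
Qed.

(** Two directions of [l1] norm at most [2] give [4 ^ 2 = 16]. In each ordered pair, one factor
    [p i j / (p i j + p j i)] is at most [1] and the remaining inverse is at most [m ^ 2 / gamma];
    there are at most [m ^ 2] pairs. *)
Lemma svm_l1_moment n (s : 'cV[R]_n.+2) (lab : 'I_n.+2 -> nat) :
  \sum_sigma rank_prob gamma s sigma *
    l1norm (score_estimator Svm gamma s (feedback 2 sigma lab)) ^+ 2 <=
  16 * n.+2%:R ^+ 4 / gamma.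
Proof.
pose p i j := top_prob gamma s [:: i; j].
pose F i j := l1norm ((p i j + p j i)^-1 *:
  (svm_dir s i j (lab i) (lab j) + svm_dir s j i (lab j) (lab i))) ^+ 2.
under eq_bigr => sigma _.
  rewrite /feedback top2 /= -/(F (sigma ord0) (sigma (lift ord0 ord0))); over.
rewrite sum_rank_prob_top2.
apply: (@le_trans _ _ (\sum_(i < n.+2) \sum_(j < n.+2) 16 * (n.+2%:R ^+ 2 / gamma))); last first.
  rewrite !sumr_const !card_ord -[_ *+ _ *+ _]mulr_natl -[_ * _ *+ _]mulr_natl.
  rewrite le_eqVlt; apply/orP; left; apply/eqP.
  by ring.
have b0 : 0 <= 16 * (n.+2%:R ^+ 2 / gamma).
  by rewrite mulr_ge0// divr_ge0 ?exprn_ge0// ltW.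
apply: ler_sum => i _.
apply: (@le_trans _ _ (\sum_(j | i != j) 16 * (n.+2%:R ^+ 2 / gamma))); last first.
  by rewrite [leRHS](bigID (fun j => i != j))/= lerDl sumr_ge0.
apply: ler_sum => j ij; rewrite -/(p i j).
have pij : 0 < p i j by apply: top_prob_gt0 => //=; rewrite inE ij.
have pji : 0 < p j i by apply: top_prob_gt0 => //=; rewrite inE eq_sym ij.
have q0 : 0 < p i j + p j i by rewrite addr_gt0.
have Fle : F i j <= (4 / (p i j + p j i)) ^+ 2.
  rewrite ler_sqr ?nnegrE ?l1norm_ge0//; last by rewrite divr_ge0// ltW.
  rewrite l1normZ ger0_norm ?invr_ge0 ?(ltW q0)// mulrC ler_wpM2r ?invr_ge0 ?(ltW q0)//.
  apply: le_trans (l1normD _ _) _.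
  by rewrite (_ : 4 = 2 + 2) ?lerD ?svm_dir_l1norm//; ring.
apply: le_trans (ler_wpM2l (ltW pij) Fle) _.
have -> : p i j * (4 / (p i j + p j i)) ^+ 2 =
   16 * ((p i j / (p i j + p j i)) * (p i j + p j i)^-1).
  by field; rewrite gt_eqF.
rewrite ler_wpM2l//; apply: (@le_trans _ _ (1 * (p i j)^-1)).
  apply: ler_pM; rewrite ?invr_ge0 ?divr_ge0 ?(ltW q0) ?(ltW pij)//.
    by rewrite ler_pdivrMr// mul1r lerDl ltW.
  by rewrite lef_pV2 ?posrE// lerDl ltW.
by rewrite mul1r; have := @invr_top_prob_le _ _ g01 _ s [:: i; j]; apply; rewrite /= inE ij.
Qed.

Lemma estimator_second_moment phi m d (X : 'M[R]_(m, d)) (lab : 'I_m -> nat)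
    (w : 'cV[R]_d) (RD U : R) Rmax :
  (topk phi <= m)%N -> 0 <= RD -> 0 <= U -> l2norm w <= U ->
  (forall i, l2norm (row i X)^T <= RD) -> (forall i, (lab i <= Rmax)%N) ->
  \sum_sigma rank_prob gamma (X *m w) sigma *
    l2norm (X^T *m score_estimator phi gamma (X *m w)
                     (feedback (topk phi) sigma lab)) ^+ 2
  <= moment_const phi RD m U Rmax / gamma.
Proof.
move=> km RD0 U0 wU XRD labR.
have g01' : 0 <= gamma <= 1 by case/andP: g01 => /ltW ->.
apply: (@le_trans _ _ (RD ^+ 2 * \sum_sigma rank_prob gamma (X *m w) sigma *
    l1norm (score_estimator phi gamma (X *m w) (feedback (topk phi) sigma lab)) ^+ 2)).
  rewrite mulr_sumr; apply: ler_sum => sigma _.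
  rewrite [leRHS]mulrCA ler_wpM2l ?rank_prob_ge0// -exprMn.
  exact: l2norm_trmx_mul_le.
have sRU i : `|(X *m w) i 0| <= RD * U by exact: score_norm_le.
have RD2 : 0 <= RD ^+ 2 by exact: sqr_ge0.
case: phi km => /= km.
- case: m km X lab XRD labR sRU => // m _ X lab XRD labR sRU.
  apply: le_trans (ler_wpM2l RD2 (sq_l1_moment sRU labR)) _.
  by rewrite le_eqVlt; apply/orP; left; apply/eqP; ring.
- case: m km X lab XRD labR sRU => // -[//|m] _ X lab XRD labR sRU.
  apply: le_trans (ler_wpM2l RD2 (svm_l1_moment _ _)) _.
  by rewrite le_eqVlt; apply/orP; left; apply/eqP; ring.
- case: m km X lab XRD labR sRU => // m _ X lab XRD labR sRU.
  apply: le_trans (ler_wpM2l RD2 (KL_l1_moment sRU labR)) _.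
  by rewrite le_eqVlt; apply/orP; left; apply/eqP; ring.
Qed.

End Moments.

(** * Expected loss of a run *)

Lemma surrogate_loss_measurable (R : realType) d (T : measurableType d) m phi
    (f : T -> 'cV[R]_m) (lab : 'I_m -> nat) :
  (forall i, measurable_fun setT (fun x => f x i 0)) ->
  measurable_fun setT (fun x => surrogate_loss phi (f x) lab).
Proof.
move=> mf; case: phi => /=.
- under eq_fun do rewrite /phi_sq l2norm_sqr /dot.
  apply: measurable_sum => i.
  under eq_fun do rewrite !mxE.
  by apply: measurable_funM; apply: measurable_funB.
- rewrite /phi_svm; apply: measurable_sum => i.
  under eq_fun do rewrite big_mkcond.
  apply: measurable_sum => j; case: (i != j); last exact: measurable_cst.
  apply: measurable_funM; first exact: measurable_cst.
  apply: measurable_maxr; first exact: measurable_cst.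
  by apply: measurable_funB => //; apply: measurable_funD.
- under eq_fun do rewrite phi_KLE.
  apply: measurable_sum => i; apply: measurable_funD.
    apply: measurable_funM; first exact: measurable_cst.
    by apply: measurable_funB => //; apply: measurable_funB.
  exact: measurableT_comp.
Qed.

Section Run.
Variables (R : realType) (m d : nat) (phi : surrogate) (U eta gamma : R).
Hypotheses (km : (topk phi <= m)%N) (U0 : 0 < U) (eta0 : 0 < eta).
Hypothesis g01 : 0 < gamma <= 1.
Implicit Types (X : nat -> 'M[R]_(m, d)) (lab : nat -> 'I_m -> nat).
Implicit Types (w u : 'cV[R]_d) (om : nat -> round_sample R m).

Let g01' : 0 <= gamma <= 1. Proof. by case/andP: g01 => /ltW ->. Qed.

(** [grad_estimator] as a function of the ranking, the only thing through which the sample of a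
    round enters the update. *)
Definition gradient_at (X0 : 'M[R]_(m, d)) (lab0 : 'I_m -> nat) w
    (sigma : {perm 'I_m}) : 'cV[R]_d :=
  X0^T *m score_estimator phi gamma (X0 *m w) (feedback (topk phi) sigma lab0).

Definition update_at (X0 : 'M[R]_(m, d)) (lab0 : 'I_m -> nat) w sigma : 'cV[R]_d :=
  project U (w - eta *: gradient_at X0 lab0 w sigma).

(** Projection does not increase the distance to [u]. Expanding the square and averaging leaves a
    cross term, bounded by [surrogate_gradient], and the second moment. *)
Lemma ogd_step (X0 : 'M[R]_(m, d)) (lab0 : 'I_m -> nat) w u (G : R) : l2norm u <= U ->
  \sum_sigma rank_prob gamma (X0 *m w) sigma *
    l2norm (gradient_at X0 lab0 w sigma) ^+ 2 <= G ->
  \sum_sigma rank_prob gamma (X0 *m w) sigma *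
    l2norm (update_at X0 lab0 w sigma - u) ^+ 2 <=
  l2norm (w - u) ^+ 2
  - 2 * eta * (surrogate_loss phi (X0 *m w) lab0 - surrogate_loss phi (X0 *m u) lab0)
  + eta ^+ 2 * G.
Proof.
move=> uU momentG; set s := X0 *m w; set s' := X0 *m u.
have := surrogate_gradient g01 s s' lab0 km.
set D := surrogate_loss _ _ _ - _ => Dle.
apply: (@le_trans _ _ (\sum_sigma rank_prob gamma s sigma *
   (l2norm (w - u) ^+ 2 - 2 * eta * dot (gradient_at X0 lab0 w sigma) (w - u)
    + eta ^+ 2 * l2norm (gradient_at X0 lab0 w sigma) ^+ 2))).
  apply: ler_sum => sigma _; rewrite ler_wpM2l ?rank_prob_ge0//.
  apply: le_trans (project_dist _ U0 uU) _.
  set z := gradient_at _ _ _ _.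
  rewrite addrAC !l2norm_sqr (dotBl (w - u)) !dotBr !dotZl !dotZr !(dotC (w - u) z).
  by rewrite !dotBl !dotBr; lra.
pose P := rank_prob gamma s.
have -> : \sum_sigma rank_prob gamma s sigma *
   (l2norm (w - u) ^+ 2 - 2 * eta * dot (gradient_at X0 lab0 w sigma) (w - u)
    + eta ^+ 2 * l2norm (gradient_at X0 lab0 w sigma) ^+ 2) =
   (\sum_sigma P sigma) * l2norm (w - u) ^+ 2
   - 2 * eta * (\sum_sigma P sigma * dot (gradient_at X0 lab0 w sigma) (w - u))
   + eta ^+ 2 * (\sum_sigma P sigma * l2norm (gradient_at X0 lab0 w sigma) ^+ 2).
  rewrite !mulr_sumr mulr_suml -sumrB -big_split; apply: eq_bigr => sigma _ /=.
  by rewrite /P; ring.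
rewrite sum_rank_prob mul1r; apply: lerD; last by rewrite ler_wpM2l ?sqr_ge0.
rewrite lerD2l lerN2 ler_wpM2l ?mulr_ge0 ?(ltW eta0)//.
apply: le_trans Dle _; rewrite le_eqVlt; apply/orP; left; apply/eqP.
by apply: eq_bigr => sigma _; rewrite /gradient_at dot_adjoint mulmxBr.
Qed.

(** [param] with an arbitrary starting point, as the induction on the number of rounds requires. *)
Fixpoint param_from X lab om w (t : nat) : 'cV[R]_d :=
  if t is t'.+1 then update phi U eta gamma (X t') (lab t') (om t') (param_from X lab om w t')
  else w.

Definition run_loss X lab n w om : R :=
  \sum_(t < n) loss_at phi (X t) (lab t) (om t) (param_from X lab om w t).

Lemma param_fromE X lab om w t : param_from X lab om w t.+1 =
  update phi U eta gamma (X t) (lab t) (om t) (param_from X lab om w t).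
Proof. by []. Qed.

(** The recursion peels off the last round, whereas the induction integrates out the first: that
    round becomes a new starting point for the shifted sequences. *)
Lemma param_fromS X lab om w t :
  param_from X lab om w t.+1 =
  param_from (X \o succn) (lab \o succn) (om \o succn)
    (update phi U eta gamma (X 0%N) (lab 0%N) (om 0%N) w) t.
Proof.
elim: t => [|t IH]; first exact: param_fromE.
by rewrite param_fromE IH [RHS]param_fromE.
Qed.

Lemma run_lossS X lab n w om :
  run_loss X lab n.+1 w om = loss_at phi (X 0%N) (lab 0%N) (om 0%N) w +
  run_loss (X \o succn) (lab \o succn) n
    (update phi U eta gamma (X 0%N) (lab 0%N) (om 0%N) w) (om \o succn).
Proof.
rewrite /run_loss big_ord_recl; congr (_ + _); apply: eq_bigr => t _.
by rewrite -param_fromS.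
Qed.

Lemma learner_lossE X lab T (om : T.-tuple (round_sample R m)) :
  learner_loss phi U eta gamma X lab om = run_loss X lab T 0 (sample_seq om).
Proof.
apply: eq_bigr => t _; congr loss_at.
elim: (t : nat) => [//|n IH]; rewrite param_fromE -IH; reflexivity.
Qed.

Lemma run_loss_ge0 X lab n w om : 0 <= run_loss X lab n w om.
Proof. by apply: sumr_ge0 => t _; exact: surrogate_loss_ge0. Qed.

Lemma measurable_loss_at (X0 : 'M[R]_(m, d)) (lab0 : 'I_m -> nat) w :
  measurable_fun setT (fun rho => loss_at phi X0 lab0 rho w).
Proof.
apply: surrogate_loss_measurable => i.
rewrite (_ : (fun _ => _) = (fun rho : round_sample R m =>
    if rho.1 then tnth rho.2 i : R else (X0 *m w) i 0)); last first.
  by apply/funext => -[[] v]; rewrite /played_score/= ?mxE.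
apply: measurable_fun_ifT => //.
by apply: (measurableT_comp (measurable_tnth i)).
Qed.

Lemma updateE (X0 : 'M[R]_(m, d)) (lab0 : 'I_m -> nat) rho w :
  update phi U eta gamma X0 lab0 rho w =
  update_at X0 lab0 w (argsort (played_score (X0 *m w) rho)).
Proof. by []. Qed.

(** After the first round the parameter is one of finitely many values [update_at _ _ w sigma]. The
    remaining loss is a sum over [sigma] of an indicator times a loss started at a fixed point, to
    which the induction hypothesis applies. *)
Lemma measurable_run_loss X lab n w :
  measurable_fun setT (fun om : n.-tuple (round_sample R m) =>
    run_loss X lab n w (sample_seq om)).
Proof.
elim: n X lab w => [|n IH] X lab w.
  under eq_fun do rewrite /run_loss big_ord0.
  exact: measurable_cst.
pose h (om : n.+1.-tuple (round_sample R m)) :=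
  argsort (played_score (X 0%N *m w) (tnth om ord0)).
have mh sigma : measurable [set om | h om = sigma].
  rewrite -[X in measurable X]setTI.
  have mA := measurable_argsort_played (X 0%N *m w) sigma.
  by have := @measurable_tnth _ _ n.+1 ord0 measurableT _ mA.
rewrite (_ : (fun _ => _) = (fun om : n.+1.-tuple (round_sample R m) =>
   loss_at phi (X 0%N) (lab 0%N) (tnth om ord0) w +
   \sum_sigma (h om == sigma)%:R *
     run_loss (X \o succn) (lab \o succn) n (update_at (X 0%N) (lab 0%N) w sigma)
       (sample_seq [tuple of behead om]))); last first.
  apply/funext => om; case/tupleP: om => rho v.
  rewrite run_lossS updateE; congr (_ + _).
  rewrite (bigD1 (h [tuple of rho :: v]))//= eqxx mul1r big1 ?addr0 => [|sigma].
    have -> : [tuple of behead [tuple of rho :: v]] = v by exact: val_inj.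
    reflexivity.
  by rewrite eq_sym => /negbTE ->; rewrite mul0r.
apply: measurable_funD.
  by apply: (measurableT_comp (measurable_loss_at _ _ _) (measurable_tnth ord0)).
apply: measurable_sum => sigma; apply: measurable_funM.
  exact: (measurable_fun_finite_factor (fun tau => (tau == sigma)%:R : R) mh).
exact: (measurableT_comp (IH (X \o succn) (lab \o succn)
  (update_at (X 0%N) (lab 0%N) w sigma)) (@measurable_behead _ (round_sample R m) n)).
Qed.

End Run.

Lemma integral_iidS (R : realType) d (T : measurableType d) (P : probability T R) n
    (f : n.+1.-tuple T -> \bar R) :
  measurable_fun setT f -> (forall v, 0 <= f v)%E ->
  (\int[iid P n.+1]_v f v =
   \int[P]_x \int[iid P n]_v f (tuple_cons (x, v)))%E.
Proof.
move=> mf f0.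
transitivity (\int[pushforward (P \x iid P n)%E (@tuple_cons _ T n)]_v f v)%E; first by [].
rewrite (ge0_integral_pushforward (@measurable_tuple_cons _ T n))//.
  rewrite preimage_setT fubini_tonelli1//.
  exact: (measurableT_comp mf (@measurable_tuple_cons _ T n)).
by move=> x; exact: f0.
Qed.

(** * The regret recursion *)

Section Regret.
Variables (R : realType) (m d : nat) (phi : surrogate) (RD U eta gamma : R) (Rmax : nat).
Hypotheses (km : (topk phi <= m)%N) (U0 : 0 < U) (eta0 : 0 < eta) (RD0 : 0 <= RD).
Hypothesis g01 : 0 < gamma <= 1.
Implicit Types (X : nat -> 'M[R]_(m, d)) (lab : nat -> 'I_m -> nat).
Implicit Types (w u : 'cV[R]_d).

Let g01' : 0 <= gamma <= 1. Proof. by case/andP: g01 => /ltW ->. Qed.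

Let G := moment_const phi RD m U Rmax.
Let B := explore_const R phi m Rmax.

(** Losses are nonnegative, so the weight [1 - gamma] of the unexplored branch is bounded by [1];
    the explored branch costs at most [gamma * B]. *)
Lemma integral_loss_at_le (X0 : 'M[R]_(m, d)) (lab0 : 'I_m -> nat) w :
  (forall i, (lab0 i <= Rmax)%N) ->
  (\int[round_law m gamma]_rho (loss_at phi X0 lab0 rho w)%:E <=
   (surrogate_loss phi (X0 *m w) lab0 + gamma * B)%:E)%E.
Proof.
move=> labR; have [ge0 ge1] := andP g01'.
have mloss := measurable_loss_at phi X0 lab0 w.
rewrite integral_round_law//; last 2 first.
- exact/measurable_EFinP.
- by move=> rho; rewrite lee_fin surrogate_loss_ge0.
rewrite [leRHS]EFinD EFinM; apply: leeD.
  rewrite /loss_at /played_score /= integral_cst//.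
  rewrite [X in (_ * (_ * X))%E](probability_setT (iid _ m)) mule1 -EFinM lee_fin.
  by rewrite ler_piMl ?surrogate_loss_ge0// lerBlDr lerDl.
apply: lee_wpmul2l; first by rewrite lee_fin.
apply: integral_iid_uniform_le.
- exact: (measurableT_comp mloss (measurable_pair1 true)).
- by move=> v; exact: surrogate_loss_ge0.
- move=> v v01; apply: surrogate_loss_le => // i.
  by rewrite /played_score /= mxE.
Qed.

(** The telescoping of gradient descent takes the form of an induction: the potential at [w] pays
    for the excess loss of the first round and the expected potential after it. *)
Lemma expected_loss_le n X lab w u : l2norm w <= U -> l2norm u <= U ->
  bounded_sequence X lab n RD Rmax ->
  (\int[iid (round_law m gamma) n]_om
     (run_loss phi U eta gamma X lab n w (sample_seq om))%:E <=
   (comparator_loss phi X lab n u + l2norm (w - u) ^+ 2 / (2 * eta)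
    + n%:R * (eta * (G / gamma) / 2 + gamma * B))%:E)%E.
Proof.
move=> + uU; elim: n X lab w => [|n IH] X lab w wU bXl.
  rewrite /comparator_loss big_ord0 mul0r addr0 add0r.
  under eq_integral do rewrite /run_loss big_ord0.
  by rewrite integral0 lee_fin divr_ge0 ?sqr_ge0// mulr_ge0// ltW.
have [XRD labR] := bXl 0%N isT.
rewrite integral_iidS; last 2 first.
- by apply/measurable_EFinP; exact: measurable_run_loss.
- by move=> v; rewrite lee_fin run_loss_ge0.
(* The bound supplied by the induction hypothesis when the first round plays the ranking [sigma]. *)
pose Z sigma := comparator_loss phi (X \o succn) (lab \o succn) n u
   + l2norm (update_at phi U eta gamma (X 0%N) (lab 0%N) w sigma - u) ^+ 2 / (2 * eta)
    + n%:R * (eta * (G / gamma) / 2 + gamma * B).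
have c0 : 0 <= eta * (G / gamma) / 2 + gamma * B.
  have [gg0 _] := andP g01.
  have G0 : 0 <= G by apply: moment_const_ge0 => //; exact: ltW.
  have B0 : 0 <= B by exact: explore_const_ge0.
  by rewrite addr_ge0 ?mulr_ge0 ?invr_ge0// ltW.
have Z0 sigma : 0 <= Z sigma.
  rewrite !addr_ge0// ?mulr_ge0 ?exprn_ge0 ?l2norm_ge0 ?invr_ge0 ?mulr_ge0 ?(ltW eta0)//.
  by apply: sumr_ge0 => t _; exact: surrogate_loss_ge0.
have mloss := measurable_loss_at phi (X 0%N) (lab 0%N) w.
pose h rho := argsort (played_score (X 0%N *m w) rho).
have mZ : measurable_fun setT (Z \o h).
  by apply: measurable_fun_finite_factor; exact: measurable_argsort_played.
pose F (z : round_sample R m * n.-tuple (round_sample R m)) :=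
  (run_loss phi U eta gamma X lab n.+1 w (sample_seq (tuple_cons z)))%:E.
have mF : measurable_fun setT F.
  apply/measurable_EFinP.
  exact: (measurableT_comp (@measurable_run_loss R m d phi U eta gamma X lab n.+1 w)
    (@measurable_tuple_cons _ (round_sample R m) n)).
have F0 z : (0 <= F z)%E by rewrite lee_fin run_loss_ge0.
have runE rho v : F (rho, v) = ((loss_at phi (X 0%N) (lab 0%N) rho w)%:E +
    (run_loss phi U eta gamma (X \o succn) (lab \o succn) n
       (update_at phi U eta gamma (X 0%N) (lab 0%N) w (h rho)) (sample_seq v))%:E)%E.
  by rewrite /F run_lossS updateE EFinD; reflexivity.
have mrun w' : measurable_fun setT (fun v : n.-tuple (round_sample R m) =>
    (run_loss phi U eta gamma (X \o succn) (lab \o succn) n w' (sample_seq v))%:E).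
  apply/measurable_EFinP.
  exact: (@measurable_run_loss R m d phi U eta gamma (X \o succn) (lab \o succn) n w').
apply: (@le_trans _ _ (\int[round_law m gamma]_rho
   ((loss_at phi (X 0%N) (lab 0%N) rho w)%:E + (Z (h rho))%:E))%E).
  apply: ge0_le_integral => //.
  - by move=> rho _; apply: integral_ge0 => v _; rewrite lee_fin run_loss_ge0.
  - exact: (@measurable_fun_fubini_tonelli_F _ _ _ _ _ (iid (round_law m gamma) n) _ mF F0).
  - by apply: emeasurable_funD; exact/measurable_EFinP.
  move=> rho _.
  under eq_integral => v _ do rewrite -[(_%:E)%E]/(F (rho, v)) runE.
  rewrite ge0_integralD//; first last.
  - by move=> v _; rewrite lee_fin run_loss_ge0.
  - by move=> v _; rewrite lee_fin surrogate_loss_ge0.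
  apply: leeD.
    rewrite [leLHS](integral_cst (iid (round_law m gamma) n) measurableT).
    by rewrite [X in (_ * X)%E](probability_setT (iid _ n)) mule1.
  apply: IH; first exact: l2norm_project.
  by move=> t tn; exact: bXl.
rewrite ge0_integralD//=; first last.
- by apply/measurable_EFinP.
- by move=> rho _; rewrite lee_fin Z0.
- by apply/measurable_EFinP.
- by move=> rho _; rewrite lee_fin surrogate_loss_ge0.
rewrite integral_argsort_played//.
apply: le_trans (leeD (integral_loss_at_le _ _ labR) (lexx _)) _.
rewrite -EFinD lee_fin.
have moment : \sum_sigma rank_prob gamma (X 0%N *m w) sigma *
    l2norm (gradient_at phi gamma (X 0%N) (lab 0%N) w sigma) ^+ 2 <= G / gamma.
  exact: estimator_second_moment (ltW U0) wU XRD labR.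
have step := ogd_step km U0 eta0 g01 uU moment.
set P := rank_prob gamma (X 0%N *m w) in step *.
set S := \sum_sigma _ in step.
(* Only the distance term of [Z] depends on [sigma], and its average is what [ogd_step] controls. *)
have -> : \sum_sigma P sigma * Z sigma =
    comparator_loss phi (X \o succn) (lab \o succn) n u + S / (2 * eta)
    + n%:R * (eta * (G / gamma) / 2 + gamma * B).
  transitivity ((\sum_sigma P sigma) *
      (comparator_loss phi (X \o succn) (lab \o succn) n u
       + n%:R * (eta * (G / gamma) / 2 + gamma * B)) + S / (2 * eta)).
    rewrite /S !mulr_suml -big_split.
    by apply: eq_bigr => sigma _; rewrite /Z /=; ring.
  by rewrite sum_rank_prob mul1r addrAC.
rewrite [X in _ <= X + _ + _]/comparator_loss big_ord_recl.
rewrite -[n.+1%:R]natr1 /comparator_loss /=.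
have : S / (2 * eta) <= l2norm (w - u) ^+ 2 / (2 * eta)
    - (surrogate_loss phi (X 0%N *m w) (lab 0%N)
       - surrogate_loss phi (X 0%N *m u) (lab 0%N)) + eta * (G / gamma) / 2.
  rewrite ler_pdivrMr ?mulr_gt0//; apply: le_trans step _.
  rewrite le_eqVlt; apply/orP; left; apply/eqP; field.
  by rewrite !gt_eqF//; case/andP: g01.
by lra.
Qed.

End Regret.

(** * Best comparator and constants *)

Section Minimizer.
Local Open Scope classical_set_scope.
Variable R : realType.

Lemma continuous_sumr (T : topologicalType) I (r : seq I) (P : pred I) (f : I -> T -> R) :
  (forall i, continuous (f i)) -> continuous (fun x => \sum_(i <- r | P i) f i x).
Proof.
move=> cf; elim: r => [|i r IH].
  by under eq_fun do rewrite big_nil; exact: cst_continuous.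
under eq_fun do rewrite big_cons; case: (P i) => // x.
by apply: continuousD; [exact: cf|exact: IH].
Qed.

Lemma surrogate_loss_continuous (T : topologicalType) m phi
    (f : T -> 'cV[R]_m) (lab : 'I_m -> nat) :
  (forall i, continuous (fun x => f x i 0)) ->
  continuous (fun x => surrogate_loss phi (f x) lab).
Proof.
move=> cf; case: phi => /=.
- under eq_fun do rewrite /phi_sq l2norm_sqr /dot.
  apply: continuous_sumr => i; under eq_fun do rewrite !mxE.
  move=> x; have cfx : {for x, continuous (fun y => f y i 0 - (lab i)%:R)}.
    by apply: continuousB; [exact: cf|exact: cst_continuous].
  exact: (continuousM cfx cfx).
- rewrite /phi_svm; apply: continuous_sumr => i; apply: continuous_sumr => j x.
  have c1 : {for x, continuous (fun y => 1 + f y j 0 - f y i 0)}.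
    apply: continuousB; last exact: cf.
    by apply: continuousD; [exact: cst_continuous|exact: cf].
  have c2 : {for x, continuous (fun y => Num.max 0 (1 + f y j 0 - f y i 0))}.
    have := @continuous_max R T (fun=> 0 : R^o) _ x (@cst_continuous T R^o 0 x) c1.
    exact.
  exact: (@continuousM R T (fun=> _) _ x (@cst_continuous T R _ x) c2).
- under eq_fun do rewrite phi_KLE.
  apply: continuous_sumr => i x.
  have c1 : {for x, continuous (fun y => (lab i)%:R - f y i 0 - 1)}.
    apply: continuousB; last exact: cst_continuous.
    by apply: continuousB; [exact: cst_continuous|exact: cf].
  have c2 : {for x, continuous (fun y => expR (f y i 0))}.
    by apply: continuous_comp; [exact: cf|exact: continuous_expR].
  apply: (@continuousD R R T _ _ x _ c2).
  exact: (@continuousM R T (fun=> _) _ x (@cst_continuous T R _ x) c1).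
Qed.

Lemma mx_norm_le_l2norm n (v : 'rV[R]_n) : `|v| <= l2norm v^T.
Proof.
rewrite [leLHS]mx_normrE; apply/bigmax_leP; split=> [|[i j] _ /=]; first exact: l2norm_ge0.
rewrite -(@ler_pXn2r _ 2)// ?nnegrE ?l2norm_ge0// l2norm_sqr real_normK ?num_real//.
rewrite /dot (bigD1 j)//= !mxE (ord1 i) expr2 lerDl.
by apply: sumr_ge0 => k _; exact: sqr_ge0.
Qed.

(** Extreme value theorem on the closed ball, with parameters transposed to rows, the form in which
    [EVT_min_rV] is stated. Boundedness is checked in the sup norm, via [mx_norm_le_l2norm]. *)
Lemma comparator_minimizer phi m d (X : nat -> 'M[R]_(m, d)) (lab : nat -> 'I_m -> nat)
    T (U : R) : 0 < U ->
  exists2 wstar : 'cV[R]_d, l2norm wstar <= U &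
    forall w, l2norm w <= U ->
      comparator_loss phi X lab T wstar <= comparator_loss phi X lab T w.
Proof.
move=> U0; pose A := [set v : 'rV[R]_d | l2norm v^T <= U].
have AE : A = (fun v : 'rV[R]_d => \sum_i v 0 i * v 0 i) @^-1` [set x | x <= U ^+ 2].
  apply/funext => v; rewrite /A /preimage /=; congr is_true.
  rewrite -(@ler_pXn2r _ 2) ?nnegrE ?l2norm_ge0 ?(ltW U0)// l2norm_sqr.
  by congr (_ <= _); apply: eq_bigr => i _; rewrite !mxE.
have closedA : closed A.
  rewrite AE; apply: closed_comp; last exact: closed_le.
  move=> v _; apply: continuous_sumr => i w.
  by apply: continuousM; exact: coord_continuous.
have compactA : compact A.
  apply: bounded_closed_compact => //.
  exists U; split; first exact: num_real.
  by move=> M UM v Av; apply: le_trans (mx_norm_le_l2norm v) _; apply: le_trans Av (ltW UM).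
have A0 : A !=set0.
  by exists 0; rewrite /A /= trmx0 l2norm0 ltW.
have cf : continuous (fun v : 'rV[R]_d => comparator_loss phi X lab T v^T).
  rewrite /comparator_loss; apply: continuous_sumr => t.
  apply: surrogate_loss_continuous => i.
  under eq_fun do rewrite mxE.
  apply: continuous_sumr => k v; under eq_fun do rewrite mxE.
  by apply: continuousM; [exact: cst_continuous|exact: coord_continuous].
have [c cA cmin] := EVT_min_rV A0 compactA (continuous_subspaceT cf).
exists c^T; first by move: cA; rewrite inE.
by move=> w wU; rewrite -[w]trmxK cmin// inE /A /= trmxK.
Qed.

End Minimizer.

(** * Polynomial form of the constant *)

Section Poly4.
Variable R : realType.

(** A polynomial may be given by a list of coefficients and exponent lists; omitted trailing
    exponents count as [0]. *)
Lemma poly4_monomials k (l : seq (R * seq nat)) :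
  all (fun p => all (fun e => (e < 5)%N) p.2) l ->
  exists c, forall v : k.-tuple R,
    poly4 c v = \sum_(p <- l) p.1 * \prod_(0 <= i < k) nth 0 v i ^+ nth 0%N p.2 i.
Proof.
elim: l => [_|[K e] l IH /= /andP[e5 /IH[c cE]]].
  exists (fun=> 0) => v; rewrite big_nil /poly4 big1// => a _; exact: mul0r.
pose a0 : {ffun 'I_k -> 'I_5} := [ffun i => inord (nth 0%N e (i : 'I_k))].
exists (fun a => K * (a == a0)%:R + c a) => v.
rewrite big_cons -cE /poly4; under [LHS]eq_bigr do rewrite mulrDl.
rewrite big_split/=; congr (_ + _).
rewrite (bigD1 a0)//= eqxx mulr1 [X in _ + X]big1 ?addr0 => [|a /negbTE ->]; last first.
  by rewrite mulr0 mul0r.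
congr (K * _); rewrite big_mkord; apply: eq_bigr => i _.
rewrite (tnth_nth 0) ffunE inordK//.
have [ie|ie] := ltnP i (size e); last by rewrite nth_default.
by apply: (allP e5); exact: mem_nth.
Qed.

(** The sum dominates each constant of the three regret terms, and the second-moment constant as
    well, so one [C] serves both claims. *)
Definition regret_const (phi : surrogate) (RD : R) (m : nat) (U : R) (Rmax : nat) : R :=
  moment_const phi RD m U Rmax + explore_const R phi m Rmax + U ^+ 2.

Lemma regret_const_admissible phi : admissible_constant phi (regret_const phi).
Proof.
case: phi => /=.
(* Exponents are listed in the order [RD], [m], [U], [Rmax], followed for [KL] by the two
   exponentials. *)
- have [//|c cE] := @poly4_monomials 4 [:: (8, [:: 4; 2; 2; 0]%N); (8, [:: 2; 2; 0; 2]%N);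
    (1, [:: 0; 1; 0; 0]%N); (1, [:: 0; 1; 0; 2]%N); (1, [:: 0; 0; 2; 0]%N)].
  exists c => RD m U Rmax.
  rewrite cE /index_iota /= !big_cons !big_nil /= /regret_const /=; ring.
- have [//|c cE] := @poly4_monomials 4 [:: (16, [:: 2; 4; 0; 0]%N); (2, [:: 0; 2; 0; 0]%N);
    (1, [:: 0; 0; 2; 0]%N)].
  exists c => RD m U Rmax.
  rewrite cE /index_iota /= !big_cons !big_nil /= /regret_const /=; ring.
- have [//|c cE] := @poly4_monomials 6 [:: (2, [:: 2; 2; 0; 0; 2; 0]%N);
    (2, [:: 2; 2; 0; 0; 0; 2]%N); (1, [:: 0; 1; 0; 1; 0; 1]%N);
    (expR 1, [:: 0; 1; 0; 0; 0; 0]%N); (1, [:: 0; 0; 2; 0; 0; 0]%N)].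
  exists c => RD m U Rmax.
  rewrite cE /index_iota /= !big_cons !big_nil /= /regret_const /=; ring.
Qed.

End Poly4.

(** * Tuning and conclusion *)

Lemma l2norm_param (R : realType) (m d : nat) phi (U eta gamma : R)
    (X : nat -> 'M[R]_(m, d)) (lab : nat -> 'I_m -> nat) om t :
  0 < U -> l2norm (param phi U eta gamma X lab om t) <= U.
Proof.
by case: t => [|t] U0; [rewrite /= l2norm0 ltW|exact: l2norm_project].
Qed.

Lemma cond_second_moment_le (R : realType) phi (m d T : nat) (RD U eta gamma : R)
    (Rmax : nat) (X : nat -> 'M[R]_(m, d)) (lab : nat -> 'I_m -> nat) om t :
  (topk phi <= m)%N -> 0 < U -> 0 <= RD -> 0 < gamma <= 1 ->
  bounded_sequence X lab T RD Rmax -> (t < T)%N ->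
  (cond_second_moment phi U eta gamma X lab om t
    <= (moment_const phi RD m U Rmax / gamma)%:E)%E.
Proof.
move=> km U0 RD0 g01 bXl tT; have [XRD labR] := bXl t tT.
have [g0 g1] := andP g01.
rewrite /cond_second_moment unlock.
set w := param _ _ _ _ _ _ _ _.
have wU : l2norm w <= U by exact: l2norm_param.
rewrite [leLHS](integral_argsort_played (X t *m w)
  (g := fun sigma => l2norm (gradient_at phi gamma (X t) (lab t) w sigma) ^+ 2)).
- rewrite lee_fin; exact: estimator_second_moment (ltW U0) wU XRD labR.
- by rewrite (ltW g0).
- by move=> sigma; exact: sqr_ge0.
Qed.

(** Expressing all powers through [r] leaves integer exponents only, which [field] can handle. *)
Lemma powR_third (R : realType) (T : nat) : (0 < T)%N ->
  exists r : R, [/\ 0 < r, T%:R = r ^+ 3, T%:R `^ (2 / 3) = r ^+ 2,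
    T%:R `^ (- (2 / 3)) = r ^- 2 & T%:R `^ (- (1 / 3)) = r^-1].
Proof.
move=> T0; have T1 : 0 < T%:R :> R by rewrite ltr0n.
exists (T%:R `^ (1 / 3)).
have rE n x : n%:R = 3 * x -> (T%:R `^ (1 / 3)) ^+ n = T%:R `^ x :> R.
  by move=> nx; rewrite -powR_mulrn ?powR_ge0// -powRrM nx; congr (_ `^ _); field.
split.
- exact: powR_gt0.
- by rewrite (rE 3%N 1) ?powRr1 ?ltW// mulr1.
- by rewrite (rE 2%N (2 / 3))//; field.
- by rewrite powRN (rE 2%N (2 / 3))//; field.
- by rewrite powRN.
Qed.

(** Here [r] stands for [T ^ (1/3)]. *)
Lemma tuned_regret (R : realType) (a1 a2 b1 b2 r eta gamma G B U D : R) :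
  0 < a1 -> 0 < a2 -> 0 < b1 -> 0 < b2 -> 0 < r -> 0 <= G -> 0 <= B ->
  a1 * r ^- 2 <= eta <= a2 * r ^- 2 -> b1 * r^-1 <= gamma <= b2 * r^-1 ->
  D <= U ^+ 2 ->
  D / (2 * eta) + r ^+ 3 * (eta * (G / gamma) / 2 + gamma * B) <=
  ((2 * a1)^-1 + a2 / (2 * b1) + b2) * (G + B + U ^+ 2) * r ^+ 2.
Proof.
move=> a1p a2p b1p b2p r0 G0 B0 /andP[eta1 eta2] /andP[gam1 gam2] DU.
have r2 : 0 < r ^+ 2 by rewrite exprn_gt0.
have eta0 : 0 < eta by apply: lt_le_trans eta1; rewrite divr_gt0.
have gam0 : 0 < gamma by apply: lt_le_trans gam1; rewrite divr_gt0.
have U2 : 0 <= U ^+ 2 by exact: sqr_ge0.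
have k1 : 0 <= (2 * a1)^-1 by rewrite invr_ge0 mulr_ge0// ltW.
have k2 : 0 <= a2 / (2 * b1) by rewrite divr_ge0 ?mulr_ge0// ltW.
have first : D / (2 * eta) <= (2 * a1)^-1 * U ^+ 2 * r ^+ 2.
  apply: (@le_trans _ _ (U ^+ 2 / (2 * eta))).
    by rewrite ler_wpM2r// invr_ge0 mulr_ge0// ltW.
  rewrite [leRHS]mulrAC [leRHS]mulrC ler_wpM2l//.
  have -> : (2 * a1)^-1 * r ^+ 2 = (2 * (a1 * r ^- 2))^-1.
    by field; rewrite !gt_eqF.
  by rewrite lef_pV2 ?posrE ?mulr_gt0 ?invr_gt0// ler_wpM2l.
(* The ratio [eta / gamma] is largest at the upper end for [eta] and the lower end for [gamma],
   where it is of order [r^-1]. *)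
have second : r ^+ 3 * (eta * (G / gamma) / 2) <= a2 / (2 * b1) * G * r ^+ 2.
  have -> : r ^+ 3 * (eta * (G / gamma) / 2) = r ^+ 3 * G / 2 * (eta / gamma).
    by field; rewrite gt_eqF.
  have -> : a2 / (2 * b1) * G * r ^+ 2 = r ^+ 3 * G / 2 * (a2 * r ^- 2 / (b1 * r^-1)).
    by field; rewrite !gt_eqF.
  rewrite ler_wpM2l//; first by rewrite divr_ge0// mulr_ge0// exprn_ge0// ltW.
  apply: ler_pM => //; [exact: ltW|by rewrite invr_ge0 ltW|].
  by rewrite lef_pV2 ?posrE// mulr_gt0 ?invr_gt0.
have third : r ^+ 3 * (gamma * B) <= b2 * B * r ^+ 2.
  have -> : b2 * B * r ^+ 2 = r ^+ 3 * ((b2 * r^-1) * B) by field; rewrite gt_eqF.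
  by rewrite ler_wpM2l ?exprn_ge0 ?(ltW r0)// ler_wpM2r.
have GBU k : 0 <= k -> [/\ k * U ^+ 2 <= k * (G + B + U ^+ 2),
    k * G <= k * (G + B + U ^+ 2) & k * B <= k * (G + B + U ^+ 2)].
  by move=> k0; split; rewrite ler_wpM2l//; lra.
have [h1 _ _] := GBU _ k1; have [_ h2 _] := GBU _ k2; have [_ _ h3] := GBU _ (ltW b2p).
rewrite mulrDr; apply: le_trans (lerD first (lerD second third)) _.
rewrite -!mulrDl ler_wpM2r ?(ltW r2)//.
by rewrite [leRHS]mulrDl [in leRHS]mulrDl -addrA lerD// lerD.
Qed.

Theorem theorem19 (R : realType) (phi : surrogate) :
  exists C : R -> nat -> R -> nat -> R,
  [/\ admissible_constant phi C,
      (forall (m d T : nat) (RD U eta gamma : R) (Rmax : nat)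
          (X : nat -> 'M[R]_(m, d)) (lab : nat -> 'I_m -> nat)
          (omega : nat -> round_sample R m) (t : nat),
        (topk phi <= m)%N -> 0 < U -> 0 <= RD ->
        0 < gamma < 2^-1 -> 0 < eta ->
        bounded_sequence X lab T RD Rmax ->
        (t < T)%N ->
        (cond_second_moment phi U eta gamma X lab omega t
           <= (C RD m U Rmax / gamma)%:E)%E)
    & (forall a1 a2 b1 b2 : R, 0 < a1 -> 0 < a2 -> 0 < b1 -> 0 < b2 ->
        exists K : R,
        forall (m d T : nat) (RD U eta gamma : R) (Rmax : nat)
          (X : nat -> 'M[R]_(m, d)) (lab : nat -> 'I_m -> nat),
        (topk phi <= m)%N -> 0 < U -> 0 <= RD -> (0 < T)%N ->
        0 < gamma < 2^-1 ->
        a1 * T%:R `^ (- (2 / 3)) <= eta <= a2 * T%:R `^ (- (2 / 3)) ->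
        b1 * T%:R `^ (- (1 / 3)) <= gamma <= b2 * T%:R `^ (- (1 / 3)) ->
        bounded_sequence X lab T RD Rmax ->
        exists wstar : 'cV[R]_d,
        [/\ l2norm wstar <= U,
            (forall w : 'cV[R]_d, l2norm w <= U ->
               comparator_loss phi X lab T wstar
                 <= comparator_loss phi X lab T w)
          & (expected_loss phi U eta gamma X lab T
               - (comparator_loss phi X lab T wstar)%:E
             <= (K * C RD m U Rmax * T%:R `^ (2 / 3))%:E)%E])].
Proof.
exists (regret_const phi); split; first exact: regret_const_admissible.
  move=> m d T RD U eta gamma Rmax X lab om t km U0 RD0 /andP[g0 g2] eta0 bXl tT.
  have g01 : 0 < gamma <= 1 by rewrite g0 ltW// (lt_trans g2)// invf_lt1 ?ltr1n.
  apply: le_trans (cond_second_moment_le _ _ km U0 RD0 g01 bXl tT) _.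
  rewrite lee_fin ler_wpM2r ?invr_ge0 ?(ltW g0)// /regret_const -addrA lerDl.
  by rewrite addr_ge0 ?sqr_ge0 ?explore_const_ge0.
move=> a1 a2 b1 b2 a1p a2p b1p b2p.
(* One summand each for the initial distance, the second moment and exploration; they depend on the
   tuning constants alone. *)
exists ((2 * a1)^-1 + a2 / (2 * b1) + b2).
move=> m d T RD U eta gamma Rmax X lab km U0 RD0 T0 /andP[g0 g2] etaT gamT bXl.
have g01 : 0 < gamma <= 1 by rewrite g0 ltW// (lt_trans g2)// invf_lt1 ?ltr1n.
have [r [r0 rT r2E rn2E rn1E]] := powR_third R T0.
rewrite rn2E in etaT; rewrite rn1E in gamT; rewrite r2E.
have eta0 : 0 < eta.
  by have /andP[+ _] := etaT; apply: lt_le_trans; rewrite divr_gt0// exprn_gt0.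
have [wstar wU wmin] := comparator_minimizer phi X lab T U0.
exists wstar; split=> //.
rewrite leeBlDr// /expected_loss unlock.
under eq_integral do rewrite learner_lossE.
have := expected_loss_le km U0 eta0 RD0 g01 _ wU bXl.
move=> /(_ 0); rewrite l2norm0 => /(_ (ltW U0)) /le_trans; apply.
rewrite lee_fin -addrA [leRHS]addrC lerD2l rT.
apply: tuned_regret => //.
- by apply: moment_const_ge0 => //; exact: ltW.
- exact: explore_const_ge0.
(* The run starts at [0], so its initial squared distance to [wstar] is at most [U ^+ 2]. *)
- rewrite sub0r -scaleN1r l2norm_sqr dotZl dotZr mulrA mulrNN mulr1 mul1r -l2norm_sqr.
  by rewrite ler_sqr ?nnegrE ?l2norm_ge0// ltW.
Qed.
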